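(* Let $(Y,C,0)$ be a quasi strong symmetry of the Brownian-motion-driven SDE $(\mu,\sigma)$, $dX^i_t=\mu^i(X_t)dt+\sigma^i_\alpha(X_t)dW^\alpha_t$, on $M$. Suppose that each $Y^i$ is linear (a polynomial of first degree) in $x^1,\dots,x^m$ and that $C$ is a constant matrix. Then $(Y,C)$ is a weak symmetry of the Milstein discretization scheme for $(\mu,\sigma)$.
   Context: Summation over repeated indices is understood. $M\subset\mathbb{R}^m$ is open with coordinates $x^1,\dots,x^m$; $W$ is a $k$-dimensional Brownian motion; $\mu$ and $\sigma=(\sigma_1,\dots,\sigma_k)$ are smooth coefficients on $M$; $L=\frac12\sum_\alpha\sigma^i_\alpha\sigma^j_\alpha\partial_{x^ix^j}+\mu^i\partial_{x^i}$. Quasi strong symmetry of the SDE $(\mu,\sigma)$: a triple $(Y,C,0)$ with $Y=Y^i\partial_{x^i}$ a vector field on $M$ and $C:M\to\mathfrak{so}(k)$ smooth such that $Y$ generates a one-parameter group on $M$ and $$Y^i\partial_{x^i}(\mu^j)-L(Y^j)=0,\qquad Y^i\partial_{x^i}(\sigma^j_\alpha)-\sigma^i_\alpha\partial_{x^i}(Y^j)+\sigma^j_\beta C^\beta_\alpha=0.$$ Milstein scheme: for deterministic times $0=t_0<t_1<\cdots$ put $\Delta t_\ell=t_\ell-t_{\ell-1}$, $\Delta W_\ell=W_{t_\ell}-W_{t_{\ell-1}}$, $\Delta\mathbb{W}^{\alpha,\beta}_\ell=\int_{t_{\ell-1}}^{t_\ell}(W^\alpha_s-W^\alpha_{t_{\ell-1}})\,dW^\beta_s$.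 The scheme is $\bar X_{t_\ell}=F(\bar X_{t_{\ell-1}},\Delta t_\ell,\Delta W_\ell,\Delta\mathbb{W}_\ell)$ with $$F^i(x,\Delta t,\Delta W,\Delta\mathbb{W})=x^i+\mu^i(x)\Delta t+\sum_{\alpha=1}^k\sigma^i_\alpha(x)\Delta W^\alpha+\frac12\sum_{j=1}^m\sum_{\alpha,\beta=1}^k\sigma^j_\alpha(x)\partial_{x^j}(\sigma^i_\beta)(x)\Delta\mathbb{W}^{\alpha,\beta};$$ it is assumed that $F$ takes values in $M$ (e.g. $M=\mathbb{R}^m$). The driving noise is the process $Z$ with values in the Lie group $N=\mathbb{R}\oplus\mathbb{R}^k\oplus(\mathbb{R}^k\otimes\mathbb{R}^k)$, with composition $(\alpha_1,a_1,b_1)\circ(\alpha_2,a_2,b_2)=(\alpha_1+\alpha_2,a_1+a_2,a_2\otimes a_1+b_1+b_2)$, equal to $(t_\ell,W_{t_\ell},(\int_0^{t_\ell}W^\alpha_sdW^\beta_s)_{\alpha\beta})$ for $t_\ell\le t<t_{\ell+1}$; its jumps $Z_{t_\ell}\circ Z_{t_{\ell-1}}^{-1}$ are $\Delta Z_{t_\ell}=(\Delta t_\ell,\Delta W_\ell,\Delta\mathbb{W}_\ell)$. A solution of the scheme is a pair $(X,Z')$ with $Z'$ having the law of $Z$ and $X_{t_\ell}=F(X_{t_{\ell-1}},\Delta Z'_{t_\ell})$, adapted to a filtration for which $Z'$ is such a discretization. Weak symmetries of the scheme: a pair $T=(\Phi,B)$ with $\Phi:M\to M$ a diffeomorphism and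 $B:M\to O(k)$ smooth acts on solutions by $P_T(X,Z)=(X',Z')$ with $X'_{t_\ell}=\Phi(X_{t_\ell})$, and $Z'$ the process with jumps (components in $\mathbb{R}$, $\mathbb{R}^k$, $\mathbb{R}^k\otimes\mathbb{R}^k$) $\Delta Z'^0_{t_\ell}=\Delta t_\ell$, $\Delta Z'^\alpha_{1,t_\ell}=B^\alpha_\beta(X_{t_{\ell-1}})\Delta Z^\beta_{1,t_\ell}$, $\Delta Z'^{\alpha\beta}_{2,t_\ell}=B^\alpha_\gamma(X_{t_{\ell-1}})B^\beta_\delta(X_{t_{\ell-1}})\Delta Z^{\gamma\delta}_{2,t_\ell}$. $T$ is a weak symmetry of the scheme if $P_T$ maps solutions to solutions of the same scheme. A pair $(Y,C)$ ($Y$ a vector field on $M$, $C:M\to\mathfrak{so}(k)$ smooth) is a weak symmetry of the scheme if all $T_a=(\Phi_a,B_a)$ are, where $\partial_a\Phi_a(x)=Y(\Phi_a(x))$, $\partial_aB_a(x)=C(\Phi_a(x))B_a(x)$, $\Phi_0=\mathrm{id}$, $B_0=I_k$. *)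

(* Defs.v *)
From HB Require Import structures.
From mathcomp Require Import all_boot all_order all_algebra.
From mathcomp Require Import all_classical all_reals all_analysis.

Set Implicit Arguments.
Unset Strict Implicit.
Unset Printing Implicit Defensive.

Import Order.TTheory GRing.Theory Num.Theory.
Import numFieldNormedType.Exports.

Local Open Scope classical_set_scope.
Local Open Scope ring_scope.

(** Points of R^m are column vectors.  A vector field is a map
    ['cV[R]_m -> 'cV[R]_m], the coefficients [sigma = (sigma_1, .., sigma_k)]
    are a map ['cV[R]_m -> 'M[R]_(m, k)] with [sigma x i a] standing for
    sigma^i_a(x).  For the square matrices B and C the row is the upper index.
    The open set M is a [set 'cV[R]_m]: maps are total, but only their
    restriction to M matters. *)

(** * Calculus on an open subset of R^m *)

Definition partial (R : realType) (m : nat) (i : 'I_m) (f : 'cV[R]_m -> R) :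
  'cV[R]_m -> R := fun x => 'D_(delta_mx i 0 : 'cV[R]_m) f x.

Definition iter_partial (R : realType) (m : nat) (s : seq 'I_m)
  (f : 'cV[R]_m -> R) : 'cV[R]_m -> R := foldr (@partial R m) f s.

Definition cpt (R : realType) (m p q : nat) (f : 'cV[R]_m -> 'M[R]_(p, q))
  (i : 'I_p) (j : 'I_q) : 'cV[R]_m -> R := fun x => f x i j.

(** C^oo on M: all iterated partial derivatives exist and are continuous. *)
Definition smooth_on (R : realType) (m p q : nat) (M : set 'cV[R]_m)
  (f : 'cV[R]_m -> 'M[R]_(p, q)) : Prop :=
  forall (i : 'I_p) (j : 'I_q) (s : seq 'I_m) (x : 'cV[R]_m), M x ->
    (forall l : 'I_m,
       derivable (iter_partial s (cpt f i j)) x (delta_mx l 0 : 'cV[R]_m)) /\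
    {for x, continuous (iter_partial s (cpt f i j))}.

Definition diffeomorphism_on (R : realType) (m : nat) (M : set 'cV[R]_m)
  (Phi : 'cV[R]_m -> 'cV[R]_m) : Prop :=
  smooth_on M Phi /\ (forall x, M x -> M (Phi x)) /\
  exists Psi : 'cV[R]_m -> 'cV[R]_m,
    smooth_on M Psi /\
    forall x, M x -> [/\ M (Psi x), Psi (Phi x) = x & Phi (Psi x) = x].

Definition is_flow (R : realType) (m : nat) (M : set 'cV[R]_m)
  (Y : 'cV[R]_m -> 'cV[R]_m) (Phi : R -> 'cV[R]_m -> 'cV[R]_m) : Prop :=
  forall x, M x ->
    Phi 0 x = x /\
    forall a : R, M (Phi a x) /\ is_derive a 1 (Phi^~ x) (Y (Phi a x)).

Definition generates_one_parameter_group (R : realType) (m : nat)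
  (M : set 'cV[R]_m) (Y : 'cV[R]_m -> 'cV[R]_m) : Prop :=
  exists Phi : R -> 'cV[R]_m -> 'cV[R]_m,
    is_flow M Y Phi /\
    forall (a b : R) x, M x -> Phi (a + b) x = Phi a (Phi b x).

(** * Quasi strong symmetries of the SDE (mu, sigma) *)

Definition generatorL (R : realType) (m k : nat) (mu : 'cV[R]_m -> 'cV[R]_m)
  (sigma : 'cV[R]_m -> 'M[R]_(m, k)) (f : 'cV[R]_m -> R) : 'cV[R]_m -> R :=
  fun x =>
    2^-1 * (\sum_(a < k) \sum_(i < m) \sum_(j < m)
              sigma x i a * sigma x j a * partial i (partial j f) x)
    + \sum_(i < m) mu x i 0 * partial i f x.

Definition quasi_strong_symmetry (R : realType) (m k : nat)
  (M : set 'cV[R]_m) (mu : 'cV[R]_m -> 'cV[R]_m)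
  (sigma : 'cV[R]_m -> 'M[R]_(m, k))
  (Y : 'cV[R]_m -> 'cV[R]_m) (C : 'cV[R]_m -> 'M[R]_k) : Prop :=
  smooth_on M Y /\ smooth_on M C /\
  (forall x, M x -> (C x)^T = - C x) /\
  generates_one_parameter_group M Y /\
  (forall x, M x -> forall j : 'I_m,
     \sum_(i < m) Y x i 0 * partial i (cpt mu j 0) x
     - generatorL mu sigma (cpt Y j 0) x = 0) /\
  (forall x, M x -> forall (j : 'I_m) (a : 'I_k),
     \sum_(i < m) Y x i 0 * partial i (cpt sigma j a) x
     - \sum_(i < m) sigma x i a * partial i (cpt Y j 0) x
     + \sum_(b < k) sigma x j b * C x b a = 0).

(** * The Lie group N = R + R^k + (R^k (x) R^k) *)

Definition noise (R : realType) (k : nat) : Type :=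
  (R * 'cV[R]_k * 'M[R]_k)%type.

(** a (x) b is the matrix [a *m b^T], of entries a^i b^j. *)
Definition nmul (R : realType) (k : nat) (z1 z2 : noise R k) : noise R k :=
  (z1.1.1 + z2.1.1, z1.1.2 + z2.1.2, z2.1.2 *m z1.1.2^T + z1.2 + z2.2).

Definition nunit (R : realType) (k : nat) : noise R k := (0, 0, 0).

Definition ninv (R : realType) (k : nat) (z : noise R k) : noise R k :=
  (- z.1.1, - z.1.2, z.1.2 *m z.1.2^T - z.2).

Lemma nmulV (R : realType) (k : nat) (z : noise R k) :
  nmul z (ninv z) = nunit R k.
Proof.
by rewrite /nmul /ninv /nunit /= !subrr mulNmx [- _ + _]addrC -opprB addNr.
Qed.

Lemma nmulA (R : realType) (k : nat) (x y z : noise R k) :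
  nmul x (nmul y z) = nmul (nmul x y) z.
Proof.
rewrite /nmul /= linearD /= mulmxDl mulmxDr !addrA; congr (_, _, _).
by rewrite [LHS](AC 6 (2*4*1*3*5*6))%AC.
Qed.

(** * Brownian motion, its discretization, and equality in law *)

Definition is_filtration (R : realType) (d : measure_display)
  (Omega : measurableType d) (F : R -> set (set Omega)) : Prop :=
  (forall t, 0 <= t -> sigma_algebra setT (F t) /\ F t `<=` measurable) /\
  (forall s t, 0 <= s -> s <= t -> F s `<=` F t).

(** Measurability of a random matrix with respect to a sub-sigma-algebra. *)
Definition measurable_wrt (R : realType) (T : Type) (p q : nat)
  (G : set (set T)) (X : T -> 'M[R]_(p, q)) : Prop :=
  forall (i : 'I_p) (j : 'I_q) (E : set R), measurable E ->
    G [set w | E (X w i j)].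

(** For s < t the increment W_t - W_s is independent of F_s and has law
    N(0, (t - s) I_k); both facts are expressed by the product formula
    ([normal_prob] takes a mean and a standard deviation). *)
Definition is_brownian (R : realType) (k : nat) (d : measure_display)
  (Omega : measurableType d) (P : probability Omega R)
  (F : R -> set (set Omega)) (W : R -> Omega -> 'cV[R]_k) : Prop :=
  (forall t, 0 <= t -> measurable_wrt (F t) (W t)) /\
  {ae P, forall w, W 0 w = 0} /\
  {ae P, forall w, {within `[0, +oo[, continuous (W^~ w)}} /\
  (forall s t, 0 <= s -> s < t ->
   forall (A : set Omega) (E : 'I_k -> set R),
     F s A -> (forall a, measurable (E a)) ->
     P (A `&` [set w | forall a, E a (W t w a 0 - W s w a 0)]) =
     (P A * \big[*%E/1%E]_(a < k) normal_prob 0 (Num.sqrt (t - s)) (E a))%E).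

Definition is_partition (R : realType) (t delta : R) (n : nat) (s : nat -> R)
  : Prop :=
  [/\ s 0%N = 0, s n = t &
      forall i, (i < n)%N -> 0 <= s i.+1 - s i < delta].

(** J is a version of (int_0^t W^a dW^b)_{a,b}: since the integrand is
    continuous and adapted, the Ito integral is the limit in probability of the
    left-point Riemann sums along partitions of [0, t] of vanishing mesh. *)
Definition is_ito_iterated_integral (R : realType) (k : nat)
  (d : measure_display) (Omega : measurableType d) (P : probability Omega R)
  (W : R -> Omega -> 'cV[R]_k) (t : R) (J : Omega -> 'M[R]_k) : Prop :=
  forall (a b : 'I_k) (eps : R), 0 < eps ->
  exists2 delta : R, 0 < delta &
    forall (n : nat) (s : nat -> R), is_partition t delta n s ->
      (P [set w | (eps <=
            `| \sum_(i < n) W (s i) w a 0 * (W (s i.+1) w b 0 - W (s i) w b 0)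
               - J w a b |)%R] <= eps%:E)%E.

(** The noise is constant on the intervals [t_l, t_(l+1)[, hence it is given
    by the sequence of its values [Z l] at the times [tau l]. *)
Definition is_discretization (R : realType) (k : nat) (d : measure_display)
  (Omega : measurableType d) (P : probability Omega R) (tau : nat -> R)
  (W : R -> Omega -> 'cV[R]_k) (Z : nat -> Omega -> noise R k) : Prop :=
  forall l : nat,
    {ae P, forall w, (Z l w).1.1 = tau l} /\
    {ae P, forall w, (Z l w).1.2 = W (tau l) w} /\
    is_ito_iterated_integral P W (tau l) (fun w => (Z l w).2).

Definition noise_adapted (R : realType) (k : nat) (Omega : Type)
  (F : R -> set (set Omega)) (tau : nat -> R) (Z : nat -> Omega -> noise R k)
  : Prop :=
  forall l : nat,
    [/\ forall E : set R, measurable E -> F (tau l) [set w | E (Z l w).1.1],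
        measurable_wrt (F (tau l)) (fun w => (Z l w).1.2) &
        measurable_wrt (F (tau l)) (fun w => (Z l w).2)].

(** [Z] is the discretization of some F-Brownian motion and is F-adapted. *)
Definition is_driving_noise (R : realType) (k : nat) (d : measure_display)
  (Omega : measurableType d) (P : probability Omega R)
  (F : R -> set (set Omega)) (tau : nat -> R) (Z : nat -> Omega -> noise R k)
  : Prop :=
  noise_adapted F tau Z /\
  exists W : R -> Omega -> 'cV[R]_k,
    is_brownian P F W /\ is_discretization P tau W Z.

(** Measurable boxes of N; they generate its Borel sigma-algebra and are stable
    under intersection, so that they determine the law of N-valued variables. *)
Definition noise_box (R : realType) (k : nat) (A0 : set R)
  (A1 : 'I_k -> set R) (A2 : 'I_k -> 'I_k -> set R) : set (noise R k) :=
  [set z : noise R k | [/\ A0 z.1.1, forall a, A1 a (z.1.2 a 0) &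
               forall a b, A2 a b (z.2 a b)]].

(** Equality of all finite-dimensional distributions. *)
Definition same_law (R : realType) (k : nat)
  (d : measure_display) (Omega : measurableType d) (P : probability Omega R)
  (Z : nat -> Omega -> noise R k)
  (d' : measure_display) (Omega' : measurableType d')
  (P' : probability Omega' R) (Z' : nat -> Omega' -> noise R k) : Prop :=
  forall (n : nat) (A0 : nat -> set R) (A1 : nat -> 'I_k -> set R)
    (A2 : nat -> 'I_k -> 'I_k -> set R),
    (forall l, measurable (A0 l)) ->
    (forall l a, measurable (A1 l a)) ->
    (forall l a b, measurable (A2 l a b)) ->
    P [set w | forall l, (l <= n)%N ->
         noise_box (A0 l) (A1 l) (A2 l) (Z l w)] =
    P' [set w | forall l, (l <= n)%N ->
         noise_box (A0 l) (A1 l) (A2 l) (Z' l w)].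

(** * The Milstein scheme and its solutions *)

Definition milstein (R : realType) (m k : nat) (mu : 'cV[R]_m -> 'cV[R]_m)
  (sigma : 'cV[R]_m -> 'M[R]_(m, k)) (x : 'cV[R]_m) (z : noise R k)
  : 'cV[R]_m :=
  \col_(i < m)
    (x i 0 + mu x i 0 * z.1.1 + \sum_(a < k) sigma x i a * z.1.2 a 0
     + 2^-1 * \sum_(j < m) \sum_(a < k) \sum_(b < k)
         sigma x j a * partial j (cpt sigma i b) x * z.2 a b).

(** [jump Z l] is the jump at the time of index [l.+1]. *)
Definition jump (R : realType) (k : nat) (Omega : Type)
  (Z : nat -> Omega -> noise R k) (l : nat) (w : Omega) : noise R k :=
  nmul (Z l.+1 w) (ninv (Z l w)).

(** [Z0], on the probability space [(Omega0, P0)], is the reference noise whose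
    law is prescribed to the noise [Z] of a solution. *)
Definition is_solution (R : realType) (m k : nat) (M : set 'cV[R]_m)
  (G : 'cV[R]_m -> noise R k -> 'cV[R]_m) (tau : nat -> R)
  (d0 : measure_display) (Omega0 : measurableType d0)
  (P0 : probability Omega0 R) (Z0 : nat -> Omega0 -> noise R k)
  (d : measure_display) (Omega : measurableType d) (P : probability Omega R)
  (F : R -> set (set Omega))
  (X : nat -> Omega -> 'cV[R]_m) (Z : nat -> Omega -> noise R k) : Prop :=
  is_filtration F /\
  is_driving_noise P F tau Z /\
  same_law P Z P0 Z0 /\
  (forall l w, M (X l w)) /\
  (forall l, measurable_wrt (F (tau l)) (X l)) /\
  (forall l, {ae P, forall w, X l.+1 w = G (X l w) (jump Z l w)}).

(** * Weak symmetries of the scheme *)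

(** The third component has entries B^a_c B^b_e z^{ce}. *)
Definition gauge (R : realType) (k : nat) (B : 'M[R]_k) (z : noise R k)
  : noise R k := (z.1.1, B *m z.1.2, B *m z.2 *m B^T).

Definition transform_X (R : realType) (m : nat) (Omega : Type)
  (Phi : 'cV[R]_m -> 'cV[R]_m) (X : nat -> Omega -> 'cV[R]_m)
  : nat -> Omega -> 'cV[R]_m := fun l w => Phi (X l w).

(** The process started at the unit of N and with jumps
    [gauge (B (X l w)) (jump Z l w)]. *)
Fixpoint transform_Z (R : realType) (m k : nat) (Omega : Type)
  (B : 'cV[R]_m -> 'M[R]_k) (X : nat -> Omega -> 'cV[R]_m)
  (Z : nat -> Omega -> noise R k) (l : nat) (w : Omega) : noise R k :=
  match l with
  | 0%N => nunit R k
  | l'.+1 =>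
      nmul (gauge (B (X l' w)) (jump Z l' w)) (transform_Z B X Z l' w)
  end.

Definition weak_symmetry (R : realType) (m k : nat) (M : set 'cV[R]_m)
  (G : 'cV[R]_m -> noise R k -> 'cV[R]_m) (tau : nat -> R)
  (d0 : measure_display) (Omega0 : measurableType d0)
  (P0 : probability Omega0 R) (Z0 : nat -> Omega0 -> noise R k)
  (Phi : 'cV[R]_m -> 'cV[R]_m) (B : 'cV[R]_m -> 'M[R]_k) : Prop :=
  diffeomorphism_on M Phi /\
  smooth_on M B /\
  (forall x, M x -> B x *m (B x)^T = 1%:M) /\
  forall (d : measure_display) (Omega : measurableType d)
    (P : probability Omega R) (F : R -> set (set Omega))
    (X : nat -> Omega -> 'cV[R]_m) (Z : nat -> Omega -> noise R k),
    is_solution M G tau P0 Z0 P F X Z ->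
    is_solution M G tau P0 Z0 P F (transform_X Phi X) (transform_Z B X Z).

(** [(Phi a, B a)] is the one-parameter family generated by [(Y, C)]. *)
Definition is_generated_family (R : realType) (m k : nat)
  (M : set 'cV[R]_m) (Y : 'cV[R]_m -> 'cV[R]_m) (C : 'cV[R]_m -> 'M[R]_k)
  (Phi : R -> 'cV[R]_m -> 'cV[R]_m) (B : R -> 'cV[R]_m -> 'M[R]_k) : Prop :=
  is_flow M Y Phi /\
  forall x, M x ->
    B 0 x = 1%:M /\
    forall a : R, is_derive a 1 (B^~ x) (C (Phi a x) *m B a x).

Definition infinitesimal_weak_symmetry (R : realType) (m k : nat)
  (M : set 'cV[R]_m) (G : 'cV[R]_m -> noise R k -> 'cV[R]_m)
  (tau : nat -> R) (d0 : measure_display) (Omega0 : measurableType d0)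
  (P0 : probability Omega0 R) (Z0 : nat -> Omega0 -> noise R k)
  (Y : 'cV[R]_m -> 'cV[R]_m) (C : 'cV[R]_m -> 'M[R]_k) : Prop :=
  (exists (Phi : R -> 'cV[R]_m -> 'cV[R]_m) (B : R -> 'cV[R]_m -> 'M[R]_k),
     is_generated_family M Y C Phi B) /\
  forall (Phi : R -> 'cV[R]_m -> 'cV[R]_m) (B : R -> 'cV[R]_m -> 'M[R]_k),
    is_generated_family M Y C Phi B ->
    forall a : R, weak_symmetry M G tau P0 Z0 (Phi a) (B a).

(* Main.v *)
Require Import Defs.
From HB Require Import structures.
From mathcomp Require Import all_boot all_order all_algebra.
From mathcomp Require Import all_classical all_reals all_analysis.
From mathcomp Require Import measurable_realfun ring lra.

Set Implicit Arguments.
Unset Strict Implicit.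
Unset Printing Implicit Defensive.

Import Order.TTheory GRing.Theory Num.Theory.
Import numFieldNormedType.Exports.

Local Open Scope classical_set_scope.
Local Open Scope ring_scope.

(**
Write Y x = A x + b and let C0 be the constant value of C. The flow of Y is
affine, Phi_a y - Phi_a x = e^(aA) (y - x), and B_a = e^(a C0) is orthogonal and
constant on M. Differentiating along the flow, the determining equations become
linear differential equations for mu(Phi_a x) and sigma(Phi_a x) B_a (the second
derivatives of Y vanish, so L Y = A mu), whence mu(Phi_a x) = e^(aA) mu(x) and
sigma(Phi_a x) B_a = e^(aA) sigma(x). One more derivative in x gives the
equivariance of the Milstein correction, so Phi_a intertwines the Milstein map
with the action z |-> B_a z of the gauge.

On the noise, multiplication by B = B_a is a group morphism, so the transformed
noise is B (Z_l o Z_0^-1), almost surely B Z_l, which discretizes B W. That B W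
is again a Brownian motion is the rotation invariance of Gaussian vectors: B is a
product of plane rotations and reflections, and in the plane the product of two
normal laws is invariant because Lebesgue measure and x^2 + y^2 are. Finally the
law of a discretized Brownian motion with its iterated integrals does not depend
on the probability space: the integrals are limits in probability of Riemann sums,
taken on one grid common to both spaces, and the increments on this grid are
independent Gaussians.
*)

(** * Linear differential equations *)

(** Affinity of [Y] matters because a Milstein step is [x] plus a finite combination of coefficients
    and noise: an affine [Phi a] acts on the increment through its linear part alone, whereas a
    curved one would create terms of higher order in the noise. Constancy of [C] makes the gauge the
    same matrix at every step, so that the product of the transformed jumps telescopes and no longer
    depends on [X]. Two features of the setting shape the details. All maps are arbitrary outside
    the open set [M], and a segment between two points of [M] may leave it; hence the affine formula
    for [Phi a] comes from comparing two flow lines in time, not from integrating in space. And a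
    noise is tied to its Brownian motion only almost surely, while the transformed noise starts
    exactly at the unit of the group; hence the division by the initial value [Z 0]. The comparison
    of laws uses no coupling: the two noises live on different spaces, each is close in probability
    to an approximation on its own space, and only the approximations are equal in law. *)

Lemma cvg_sum (R : realType) (V : normedModType R) (T : Type) (F : set_system T)
  {FF : Filter F} p (f : 'I_p -> T -> V) (a : 'I_p -> V) :
  (forall l, f l x @[x --> F] --> a l) ->
  \sum_l f l x @[x --> F] --> \sum_l a l.
Proof. by move=> fa; apply: cvg_big => //; exact: add_continuous. Qed.

Section matrix_derive.
Context {R : realType}.

Lemma is_derive_mxP p q (f : R -> 'M[R]_(p, q)) (t : R) (D : 'M[R]_(p, q)) :
  is_derive t 1 f D <-> forall i j, is_derive t 1 (fun s => f s i j) (D i j).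
Proof.
split=> [[df <-] i j|H].
  split; first by move: i j; apply/derivable_mxP.
  by rewrite derive_mx// mxE.
have df : derivable f t 1 by apply/derivable_mxP => i j; case: (H i j).
split=> //; rewrite derive_mx//; apply/matrixP => i j; rewrite mxE.
by case: (H i j).
Qed.

Lemma is_derive_mulmx p q r (f : R -> 'M[R]_(p, q)) (g : R -> 'M[R]_(q, r)) (t : R) f' g' :
  is_derive t 1 f f' -> is_derive t 1 g g' ->
  is_derive t 1 (fun s => f s *m g s) (f' *m g t + f t *m g').
Proof.
move=> /is_derive_mxP df /is_derive_mxP dg; apply/is_derive_mxP => i j.
rewrite (_ : (fun s => _) = \sum_(l < q) ((fun s => f s i l) * (fun s => g s l j))).
  have H := is_derive_sum (fun l => is_deriveM (df i l) (dg l j)).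
  apply: is_derive_eq H _.
  rewrite !mxE -big_split/=; apply: eq_bigr => l _.
  by rewrite /GRing.scale/= addrC; congr (_ + _); rewrite mulrC.
by apply/funext => s; rewrite mxE fct_sumE.
Qed.

Lemma is_derive_mulmxl p q r (A : 'M[R]_(p, q)) (g : R -> 'M[R]_(q, r)) (t : R) g' :
  is_derive t 1 g g' -> is_derive t 1 (fun s => A *m g s) (A *m g').
Proof.
move=> dg; have dA : is_derive t 1 (fun _ : R => A) 0 by exact: is_derive_cst.
by apply: is_derive_eq (is_derive_mulmx dA dg) _; rewrite mul0mx add0r.
Qed.

Lemma is_derive_mx_comp p q (f : R -> 'M[R]_(p, q)) (h : R -> R) (t : R) f' h' :
  is_derive (h t) 1 f f' -> is_derive t 1 h h' ->
  is_derive t 1 (fun s => f (h s)) (h' *: f').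
Proof.
move=> /is_derive_mxP df dh; apply/is_derive_mxP => i j; rewrite mxE mulrC.
exact: (is_derive1_comp (f := fun s => f s i j)).
Qed.

Lemma mx_is_derive_0_is_cst p q (f : R -> 'M[R]_(p, q)) (s t : R) :
  (forall x : R, is_derive x 1 f 0) -> f s = f t.
Proof.
move=> df; apply/matrixP => i j.
apply: (is_derive_0_is_cst (f := fun x => f x i j)) => x.
by have /is_derive_mxP/(_ i j) := df x; rewrite mxE.
Qed.

End matrix_derive.

(** * The matrix exponential and uniqueness for linear systems *)

Section matrix_exponential.
Context {R : realType} {n : nat}.
Implicit Type A : 'M[R]_n.

Definition expm_coeff A i j (N : nat) : R := (A ^+ N) i j / N`!%:R.

(** Entrywise, each coefficient is a real power series in [t], so term-by-term differentiation of
    scalar power series applies. *)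
Definition expm A (t : R) : 'M[R]_n :=
  \matrix_(i, j) limn (pseries (expm_coeff A i j) t).

(** The norm is the largest entry in absolute value, which is not submultiplicative; the factor [n]
    pays for the [n] terms of each entry of a product. *)
Lemma normr_expmx_le A i j N :
  `|(A ^+ N) i j| <= (n%:R * `|A|) ^+ N.
Proof.
elim: N i j => [|N IH] i j.
  by rewrite !expr0 mxE; case: eqP; rewrite ?normr1 ?normr0.
rewrite exprS mxE (le_trans (ler_norm_sum _ _ _))//.
have -> : (n%:R * `|A|) ^+ N.+1 = \sum_(l < n) (`|A| * (n%:R * `|A|) ^+ N).
  by rewrite sumr_const card_ord -[RHS]mulr_natl exprS mulrA.
apply: ler_sum => l _; rewrite normrM ler_pM//.
rewrite [leRHS]/Num.Def.normr/= mx_normrE.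
exact: (le_bigmax _ (fun i : 'I_n * 'I_n => `|A i.1 i.2|) (i, l)).
Qed.

(** Comparison with the scalar exponential series at [n |A| |t|]. The constant [c] lets the bound
    cover also the series differentiated once and twice. *)
Lemma is_cvg_expm_pseries A (f : R^nat) t c :
  (forall N, `|f N| <= c * ((n%:R * `|A|) ^+ N / N`!%:R)) -> 0 <= c ->
  cvgn (pseries f t).
Proof.
move=> fle c0; apply: normed_cvg.
apply: (@series_le_cvg _ _ (c *: exp_coeff (n%:R * `|A| * `|t|))) => //.
- by move=> N /=.
- by move=> N; apply: mulr_ge0; rewrite // exp_coeff_ge0// !mulr_ge0.
- move=> N /=; rewrite normrM [leRHS]/GRing.scale/= /exp_coeff/=.
  have -> : c *: ((n%:R * `|A| * `|t|) ^+ N / N`!%:R) =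
      c * ((n%:R * `|A|) ^+ N / N`!%:R) * `|t| ^+ N.
    by rewrite /GRing.scale/= (exprMn _ (n%:R * `|A|)) -!mulrA [_ * N`!%:R^-1]mulrC.
  by rewrite normrX ler_wpM2r ?exprn_ge0.
- exact/is_cvg_seriesZ/is_cvg_series_exp_coeff.
Qed.

Lemma expm_coeff_le A i j N : `|expm_coeff A i j N| <= 1 * ((n%:R * `|A|) ^+ N / N`!%:R).
Proof.
by rewrite mul1r normrM [X in _ * X]ger0_norm ?invr_ge0// ler_wpM2r ?invr_ge0 ?normr_expmx_le.
Qed.

Lemma pseries_diffs_expm A i j N :
  pseries_diffs (expm_coeff A i j) N = (A ^+ N.+1) i j / N`!%:R.
Proof.
rewrite /pseries_diffs /expm_coeff factS natrM invfM mulrCA.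
by rewrite [X in _ * X]mulrA divff ?pnatr_eq0// mul1r.
Qed.

Lemma is_cvg_expm_pseriesE A i j t : cvgn (pseries (expm_coeff A i j) t).
Proof. exact: (is_cvg_expm_pseries (expm_coeff_le _ _ _)). Qed.

Lemma expm_series_diff A i j (t : R) :
  is_derive t 1 (fun s => expm A s i j)
    (limn (pseries (pseries_diffs (expm_coeff A i j)) t)).
Proof.
rewrite (_ : (fun s => _) = fun s => limn (pseries (expm_coeff A i j) s)); last first.
  by apply/funext => s; rewrite mxE.
have t0 : 0 <= n%:R * `|A| by rewrite mulr_ge0.
(* Any point of modulus larger than that of [t] would do. Each formal derivative raises the power of
   [A] by one, whence the constants [n |A|] and its square below. *)
apply: (@pseries_snd_diffs _ _ (`|t| + 1)).
- exact: is_cvg_expm_pseriesE.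
- apply: (@is_cvg_expm_pseries A _ _ (n%:R * `|A|)) => // N.
  rewrite pseries_diffs_expm normrM [X in _ * X]ger0_norm ?invr_ge0//.
  by rewrite mulrA -exprS ler_wpM2r ?invr_ge0 ?normr_expmx_le.
- apply: (@is_cvg_expm_pseries A _ _ ((n%:R * `|A|) ^+ 2)); last exact: exprn_ge0.
  move=> N; rewrite {1}/pseries_diffs pseries_diffs_expm factS natrM invfM mulrCA.
  rewrite [X in `|_ * X|]mulrA divff ?pnatr_eq0// mul1r.
  rewrite normrM [X in _ * X]ger0_norm ?invr_ge0//.
  by rewrite mulrA -exprD ler_wpM2r ?invr_ge0 ?normr_expmx_le.
- by rewrite [ltRHS]ger0_norm ?addr_ge0// ltrDl.
Qed.

Lemma pseries_sum p (c : 'I_p -> R) (f : 'I_p -> R^nat) (g : R^nat) t :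
  (forall l, cvgn (pseries (f l) t)) ->
  (forall N, g N = \sum_l c l * f l N) ->
  limn (pseries g t) = \sum_l c l * limn (pseries (f l) t).
Proof.
move=> cf gE; apply/cvg_lim => //.
have -> : pseries g t = fun N => \sum_l c l * pseries (f l) t N.
  apply/funext => N; rewrite /pseries /series/=.
  under eq_bigr do rewrite gE mulr_suml.
  rewrite exchange_big/=; apply: eq_bigr => l _; rewrite mulr_sumr.
  by apply: eq_bigr => ? _; rewrite mulrA.
apply: cvg_sum => l; apply: cvgMl_tmp; exact: cf.
Qed.

Lemma is_derive_expml A (t : R) : is_derive t 1 (expm A) (A *m expm A t).
Proof.
apply/is_derive_mxP => i j; apply: is_derive_eq (expm_series_diff A i j t) _.
rewrite mxE; under eq_bigr do rewrite [expm A t _ _]mxE.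
apply: pseries_sum => [l|N]; first exact: is_cvg_expm_pseriesE.
by rewrite pseries_diffs_expm exprS mxE mulr_suml; under eq_bigr do rewrite -mulrA.
Qed.

(** The same series with [A] factored out on the right. This form is the one that cancels in the
    product rule for [expm A (- t) *m u t]. *)
Lemma is_derive_expmr A (t : R) : is_derive t 1 (expm A) (expm A t *m A).
Proof.
apply/is_derive_mxP => i j; apply: is_derive_eq (expm_series_diff A i j t) _.
rewrite mxE; under eq_bigr do rewrite [expm A t _ _]mxE mulrC.
apply: pseries_sum => [l|N]; first exact: is_cvg_expm_pseriesE.
rewrite pseries_diffs_expm exprSr mxE mulr_suml.
by under eq_bigr do rewrite mulrAC mulrC.
Qed.

Lemma expm0 A : expm A 0 = 1%:M.
Proof.
apply/matrixP => i j; rewrite !mxE; apply/cvg_lim => //.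
rewrite -cvg_shiftS/=; rewrite (_ : (fun _ => _) = cst (i == j)%:R); first exact: cvg_cst.
apply/funext => N; rewrite /pseries /series/= big_nat_recl// big1 ?addr0.
  by rewrite expr0 mulr1 /expm_coeff expr0 fact0 invr1 mulr1 mxE.
by move=> l _; rewrite exprS mul0r mulr0.
Qed.

Lemma is_derive_expmN A (t : R) : is_derive t 1 (fun s => expm A (- s)) (- (expm A (- t) *m A)).
Proof.
apply: is_derive_eq (is_derive_mx_comp (is_derive_expmr A _) (is_deriveNid _ _)) _.
by rewrite scaleN1r.
Qed.

(** The derivative of the product is [- e^(-tA) A u + e^(-tA) A u = 0]; uniqueness of solutions
    follows with no fixed-point argument. *)
Lemma linear_ode_cst A p (u : R -> 'M[R]_(n, p)) :
  (forall t : R, is_derive t 1 u (A *m u t)) -> forall t, expm A (- t) *m u t = u 0.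
Proof.
move=> du t; transitivity (expm A (- 0) *m u 0); last by rewrite oppr0 expm0 mul1mx.
apply: (mx_is_derive_0_is_cst (f := fun s => expm A (- s) *m u s)) => x.
apply: is_derive_eq (is_derive_mulmx (is_derive_expmN A x) (du x)) _.
by rewrite mulmxA mulNmx addNr.
Qed.

Lemma expmNK A t : expm A (- t) *m expm A t = 1%:M.
Proof. by rewrite (linear_ode_cst (is_derive_expml A)) expm0. Qed.

Lemma linear_ode_unique A p (u : R -> 'M[R]_(n, p)) :
  (forall t : R, is_derive t 1 u (A *m u t)) -> forall t, u t = expm A t *m u 0.
Proof.
move=> du t; rewrite -(linear_ode_cst du t) mulmxA.
by rewrite (mulmx1C (expmNK A t)) mul1mx.
Qed.

(** With [E = e^(tA)], the derivative of [E^T E] is [E^T (A^T + A) E = 0], and the value at 0 is the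
    identity. *)
Lemma expm_orthogonal A t : A^T = - A -> expm A t *m (expm A t)^T = 1%:M.
Proof.
move=> AT; apply: mulmx1C.
rewrite -[RHS](_ : (expm A 0)^T *m expm A 0 = _); last by rewrite expm0 trmx1 mulmx1.
apply: (mx_is_derive_0_is_cst (f := fun s => (expm A s)^T *m expm A s)) => x.
have dT : is_derive x 1 (fun s => (expm A s)^T) ((A *m expm A x)^T).
  apply/is_derive_mxP => i j; rewrite mxE.
  rewrite (_ : (fun s => _) = fun s => expm A s j i).
    exact: (is_derive_mxP _ _ _).1 (is_derive_expml A x) j i.
  by apply/funext => s; rewrite mxE.
apply: is_derive_eq (is_derive_mulmx dT (is_derive_expml A x)) _.
by rewrite trmx_mul AT mulmxN mulNmx mulmxA addNr.
Qed.

End matrix_exponential.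

(** * The chain rule for smooth maps on an open set *)

Section frechet.
Context {R : realType} {m : nat}.
Implicit Types (g : 'cV[R]_m -> R) (x v h : 'cV[R]_m).

(** A mean value theorem for either sign of [t], since the coordinates of an increment have no fixed
    sign. *)
Lemma mvt_from0 (f df : R -> R) (t : R) :
  (forall s : R, `|s| <= `|t| -> is_derive s 1 f (df s)) ->
  exists2 c : R, `|c| <= `|t| & f t - f 0 = df c * t.
Proof.
move=> H.
have cont : forall s, `|s| <= `|t| -> {for s, continuous f}.
  by move=> s /H[d _]; exact/differentiable_continuous/derivable1_diffP.
have [t0|/ltW t0] := leP 0 t.
  have [s| |c] := @MVT_segment _ f df 0 t t0.
  - by rewrite in_itv/= => /andP[s0 st]; apply: H; rewrite !ger0_norm// ltW.
  - apply: continuous_in_subspaceT => s /set_mem/=; rewrite in_itv/= => /andP[s0 st].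
    by apply: cont; rewrite !ger0_norm.
  rewrite in_itv/= subr0 => /andP[c0 ct] ->.
  by exists c; rewrite // !ger0_norm.
have [s| |c] := @MVT_segment _ f df t 0 t0.
- by rewrite in_itv/= => /andP[s0 st]; apply: H; rewrite !ler0_norm ?lerN2// ltW.
- apply: continuous_in_subspaceT => s /set_mem/=; rewrite in_itv/= => /andP[s0 st].
  by apply: cont; rewrite !ler0_norm ?lerN2.
rewrite in_itv/= sub0r => /andP[tc c0] E.
exists c; first by rewrite !ler0_norm// lerN2.
by rewrite -opprB E mulrN opprK.
Qed.

Lemma is_derive_line (W : normedModType R) (g : 'cV[R]_m -> W) x v (s : R) :
  derivable g (s *: v + x) v ->
  is_derive s 1 (fun t : R => g (t *: v + x)) ('D_v g (s *: v + x)).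
Proof.
move=> H.
have E : (fun h : R => h^-1 *: (g (h *: v + (s *: v + x)) - g (s *: v + x))) =
  (fun h : R => h^-1 *: (g ((h *: 1 + s) *: v + x) - g (s *: v + x))).
  by apply/funext => h; rewrite scalerDl addrA [_%:A]mulr1.
split; first by move: H; rewrite /derivable E.
by rewrite /derive E.
Qed.

(** Vertices of the broken line from 0 to [h] that moves along one coordinate at a time. In the
    maximum norm it never leaves the ball of radius [|h|]. *)
Definition truncate (i : nat) (h : 'cV[R]_m) : 'cV[R]_m :=
  \col_l (if (l < i)%N then h l 0 else 0).

Lemma truncateS (i : 'I_m) h :
  truncate i.+1 h = h i 0 *: delta_mx i 0 + truncate i h.
Proof.
apply/matrixP => l j; rewrite !mxE (ord1 j) eqxx andbT ltnS leq_eqVlt.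
rewrite -val_eqE/=; case: eqP => [/val_inj->|_] /=; last by rewrite mulr0 add0r.
by rewrite ltnn mulr1 addr0.
Qed.

Lemma coord_norm_le (h : 'cV[R]_m) l : `|h l 0| <= `|h|.
Proof.
rewrite [leRHS]/Num.Def.normr/= mx_normrE.
exact: (le_bigmax _ (fun i : 'I_m * 'I_1 => `|h i.1 i.2|) (l, 0)).
Qed.

Lemma norm_truncate_le (i : 'I_m) h (s : R) : `|s| <= `|h i 0| ->
  `|s *: delta_mx i 0 + truncate i h| <= `|h|.
Proof.
move=> sh; rewrite [leLHS]/Num.Def.normr/= mx_normrE; apply: bigmax_le => //= -[l j] _ /=.
rewrite !mxE (ord1 j) eqxx andbT.
case: eqP => [->|_] /=.
  by rewrite ltnn mulr1 addr0 (le_trans sh)// coord_norm_le.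
by rewrite mulr0 add0r; case: ifP; rewrite ?normr0// coord_norm_le.
Qed.

Lemma increment_partials g x h (r : R) : `|h| < r ->
  (forall y, `|y - x| < r -> forall l, derivable g y (delta_mx l 0)) ->
  exists xi : 'I_m -> 'cV[R]_m, (forall l, `|xi l - x| <= `|h|) /\
    g (h + x) - g x = \sum_l h l 0 * partial l g (xi l).
Proof.
move=> hr dg.
have step (i : 'I_m) : exists xi, `|xi - x| <= `|h| /\
    g (truncate i.+1 h + x) - g (truncate i h + x) = h i 0 * partial i g xi.
  have [s sh|c ch] := @mvt_from0 (fun s => g (s *: delta_mx i 0 + (truncate i h + x)))
    (fun s => partial i g (s *: delta_mx i 0 + (truncate i h + x))) (h i 0).
    apply: is_derive_line; apply: dg; rewrite addrA addrK.
    by rewrite (le_lt_trans _ hr)// norm_truncate_le.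
  rewrite addrA -truncateS scale0r add0r mulrC => E.
  eexists; split; last exact: E.
  by rewrite addrA addrK norm_truncate_le.
have [xi xiP] := choice step; exists xi; split; first by move=> l; case: (xiP l).
have <- : \sum_(i < m) (g (truncate i.+1 h + x) - g (truncate i h + x)) = g (h + x) - g x.
  rewrite -(big_mkord xpredT (fun i => g (truncate i.+1 h + x) - g (truncate i h + x))).
  rewrite telescope_sumr//; congr (g _ - g _).
    by congr (_ + _); apply/matrixP => l j; rewrite !mxE ltn_ord (ord1 j).
  by rewrite -[RHS]add0r; congr (_ + _); apply/matrixP => l j; rewrite !mxE.
by apply: eq_bigr => i _; case: (xiP i).
Qed.

(** [smooth_on] speaks of partial derivatives only, while the chain rule along a curve needs the
    full differential. The mean value form of the increment compares each partial derivative at a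
    nearby point with its value at [x]. *)
Lemma differentiable_partials g x :
  (\forall y \near x, forall l, derivable g y (delta_mx l 0)) ->
  (forall l, {for x, continuous (partial l g)}) ->
  differentiable g x /\ forall v, 'd g x v = \sum_l v l 0 * partial l g x.
Proof.
move=> dg cg.
have @df : {linear 'cV[R]_m -> R}.
  exists (fun v => \sum_l v l 0 * partial l g x : R); do 2![eexists]; do ?[constructor].
  - by apply: big1 => l _; rewrite mxE mul0r.
  - move=> ? ?; rewrite -big_split/=; apply: eq_bigr => l _.
    by rewrite !mxE mulrDl.
  - move=> ? ?; rewrite scaler_sumr; apply: eq_bigr => l _.
    by rewrite !mxE /GRing.scale/= mulrA.
have cdf : continuous df.
  move=> v; apply: (@cvg_sum R _ _ (nbhs v) _ _ (fun l (w : 'cV[R]_m) => w l 0 * partial l g x)).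
  by move=> l; apply: cvgMr_tmp; exact: coord_continuous.
have lit : g \o shift x = cst (g x) + df +o_ (0 : 'cV[R]_m) id.
  apply/eqaddoP => e e0.
  have m0 : 0 < m%:R + 1 :> R by rewrite ltr_pwDr.
  (* The error is a sum of [m] terms of size at most [|h| e']; the added 1 keeps the denominator
     positive when [m = 0]. *)
  pose e' := e / (m%:R + 1).
  have e'0 : 0 < e' by rewrite divr_gt0.
  have near_cg : \forall y \near x, forall l, `|partial l g x - partial l g y| <= e'.
    pose f l := [set y | `|partial l g x - partial l g y| <= e'].
    suff : \forall y \near nbhs x, forall l, f l y by [].
    apply: (@filter_forall _ _ f) => l.
    by move/cvgrPdist_le : (cg l); apply.
  have /nbhs_ballP[r /= r0 xr] : \forall y \near x,
      (forall l, derivable g y (delta_mx l 0)) /\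
      (forall l, `|partial l g x - partial l g y| <= e').
    by near=> y; split; near: y.
  have ballx y : `|y - x| < r -> ball x r y.
    by rewrite mx_norm_ball /ball_ /= distrC.
  apply/nbhs_ballP; exists r => //= h; rewrite mx_norm_ball /ball_/= sub0r normrN => hr.
  have [y /ballx/xr[]//|xi [xih E]] := @increment_partials g x h r hr.
  rewrite !fctE/= opprD addrA E/= -sumrB.
  rewrite (le_trans (ler_norm_sum _ _ _))//.
  apply: (@le_trans _ _ (\sum_(l < m) (`|h| * e'))).
    apply: ler_sum => l _; rewrite -mulrBr normrM ler_pM// ?coord_norm_le// distrC.
    by have /xr[_] := ballx _ (le_lt_trans (xih l) hr); apply.
  rewrite sumr_const card_ord -[leLHS]mulr_natl mulrCA mulrC ler_wpM2r//.
  by rewrite /e' mulrCA ger_pMr// ler_pdivrMr// mul1r lerDl.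
have E := diff_unique cdf lit.
split; last by move=> v; rewrite E.
by apply/diff_locallyP; rewrite E.
Unshelve. all: by end_near. Qed.

Lemma is_derive_comp_curve g (c : R -> 'cV[R]_m) (t : R) c' :
  is_derive t 1 c c' -> differentiable g (c t) ->
  is_derive t 1 (g \o c) ('d g (c t) c').
Proof.
move=> [/derivable1_diffP dc dcE] dg.
have dgc : differentiable (g \o c) t by exact: differentiable_comp.
split; first exact/derivable1_diffP.
by rewrite -dcE (deriveE _ dgc) (deriveE _ dc) diff_comp.
Qed.

End frechet.

Section smooth.
Context {R : realType} {m : nat} (M : set 'cV[R]_m) (M_open : open M).

(** The directional derivative of [f] at [x] along [v], written with partial derivatives: it is
    linear in [v] and has the shape of the sums in the symmetry equations. *)
Definition jacobian_at p q (f : 'cV[R]_m -> 'M[R]_(p, q)) (x v : 'cV[R]_m)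
  : 'M[R]_(p, q) := \matrix_(i, j) \sum_l v l 0 * partial l (cpt f i j) x.

Lemma smooth_on_chain p q (f : 'cV[R]_m -> 'M[R]_(p, q)) (c : R -> 'cV[R]_m) (t : R) c' :
  smooth_on M f -> M (c t) -> is_derive t 1 c c' ->
  is_derive t 1 (fun s => f (c s)) (jacobian_at f (c t) c').
Proof.
move=> sf Mc dc; apply/is_derive_mxP => i j; rewrite mxE.
have [||dg <-] := @differentiable_partials _ _ (cpt f i j) (c t).
- have : \forall y \near c t, M y by exact: open_nbhs_nbhs.
  by apply: filterS => y My l; have [+ _] := sf i j [::] y My; exact.
- by move=> l; have [_ +] := sf i j [:: l] _ Mc.
exact: is_derive_comp_curve.
Qed.

Definition affine_on (g : 'cV[R]_m -> R) :=
  exists (c : R) (e : 'rV[R]_m), forall x, M x -> g x = c + (e *m x) 0 0.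

(** Outside [M] the values of [g] are unknown, but [M] is open, so the difference quotient at [x] is
    eventually constant. *)
Lemma is_derive_affine (g : 'cV[R]_m -> R) c (e : 'rV[R]_m) x v :
  (forall x, M x -> g x = c + (e *m x) 0 0) -> M x ->
  is_derive x v g ((e *m v) 0 0).
Proof.
move=> gE Mx.
have H : h^-1 *: (g (h *: v + x) - g x) @[h --> 0^'] --> (e *m v) 0 0.
  apply: cvg_near_cst; near=> h.
  rewrite !gE//; last first.
    near: h; apply: cvg_within.
    have : (fun h : R => h *: v + x) h @[h --> 0] --> x.
      rewrite -[X in _ --> X]add0r -[X in _ --> X + _](scale0r v).
      by apply: cvgD; [apply: cvgZr_tmp; exact: cvg_id|exact: cvg_cst].
    by apply; exact: open_nbhs_nbhs.
  have h0 : h != 0 by near: h; exact: nbhs_dnbhs_neq.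
  have -> : (e *m (h *: v + x)) 0 0 = h * (e *m v) 0 0 + (e *m x) 0 0.
    by rewrite mulmxDr -scalemxAr mxE [X in X + _]mxE.
  rewrite opprD addrACA subrr add0r addrK.
  by rewrite /GRing.scale/= mulKf.
split; first by apply/cvg_ex; eexists; exact: H.
exact/cvg_lim.
Unshelve. all: by end_near. Qed.

Lemma partial_affine (g : 'cV[R]_m -> R) c (e : 'rV[R]_m) x l :
  (forall x, M x -> g x = c + (e *m x) 0 0) -> M x -> partial l g x = e 0 l.
Proof.
move=> gE Mx; have [_] := is_derive_affine (delta_mx l 0) gE Mx.
by rewrite /partial => ->; rewrite -colE mxE.
Qed.

(** A partial derivative is constant on [M], hence again affine there: this closes the induction on
    iterated partial derivatives in the proof of smoothness. *)
Lemma affine_on_partial g l : affine_on g -> affine_on (partial l g).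
Proof.
move=> [c [e gE]]; exists (e 0 l), 0 => x Mx.
by rewrite (partial_affine _ gE Mx) mul0mx mxE addr0.
Qed.

Lemma affine_on_smooth p q (f : 'cV[R]_m -> 'M[R]_(p, q)) :
  (forall i j, affine_on (cpt f i j)) -> smooth_on M f.
Proof.
move=> H i j s x Mx.
have [c [e gE]] : affine_on (iter_partial s (cpt f i j)).
  by elim: s => [|l s IH]; [exact: H|exact: affine_on_partial].
split; first by move=> l; have [] := is_derive_affine (delta_mx l 0) gE Mx.
have E : \forall y \near x, c + (e *m y) 0 0 = iter_partial s (cpt f i j) y.
  have : \forall y \near x, M y by exact: open_nbhs_nbhs.
  by apply: filterS => y My; rewrite gE.
rewrite /prop_for/= /continuous_at gE//.
apply: cvg_trans; first exact: (near_eq_cvg E).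
apply: cvgD; first exact: cvg_cst.
rewrite mxE; under eq_fun do rewrite mxE.
apply: (@cvg_sum R _ _ (nbhs x) _ _ (fun l (w : 'cV[R]_m) => e 0 l * w l 0)) => l.
by apply: cvgMl_tmp; exact: coord_continuous.
Qed.

End smooth.

(** * Equivariance of the Milstein map *)

Section affine_flow.
Context {R : realType} {m : nat} (M : set 'cV[R]_m) (M_open : open M).
Variables (Y : 'cV[R]_m -> 'cV[R]_m) (A : 'M[R]_m) (b : 'cV[R]_m).
Hypothesis YE : forall x, M x -> Y x = A *m x + b.
Variable Phi : R -> 'cV[R]_m -> 'cV[R]_m.
Hypothesis flowPhi : is_flow M Y Phi.

Lemma flow_in a x : M x -> M (Phi a x).
Proof. by move=> /flowPhi[_ /(_ a)[]]. Qed.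

Lemma flow0 x : M x -> Phi 0 x = x.
Proof. by move=> /flowPhi[]. Qed.

Lemma is_derive_flow (a : R) x : M x -> is_derive a 1 (Phi^~ x) (Y (Phi a x)).
Proof. by move=> /flowPhi[_ /(_ a)[]]. Qed.

(** The constant [b] cancels in the difference of two integral curves, which therefore solves the
    homogeneous system [u' = A u]. *)
Lemma curves_diff (u v : R -> 'cV[R]_m) :
  (forall t, M (u t)) -> (forall t, M (v t)) ->
  (forall t : R, is_derive t 1 u (Y (u t))) ->
  (forall t : R, is_derive t 1 v (Y (v t))) ->
  forall t, u t - v t = expm A t *m (u 0 - v 0).
Proof.
move=> Mu Mv du dv t; apply: (linear_ode_unique (u := fun t => u t - v t)) => s.
apply: is_derive_eq (is_deriveB (du s) (dv s)) _.
by rewrite !YE// opprD addrACA subrr addr0 mulmxBr.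
Qed.

Lemma flow_diff a x y : M x -> M y -> Phi a y - Phi a x = expm A a *m (y - x).
Proof.
move=> Mx My; have := curves_diff (fun t => flow_in t My) (fun t => flow_in t Mx)
  (fun t => is_derive_flow t My) (fun t => is_derive_flow t Mx) a.
by rewrite !flow0.
Qed.

Lemma flow_affine a x y : M x -> M y -> Phi a y = Phi a x + expm A a *m (y - x).
Proof. by move=> Mx My; rewrite -flow_diff// addrC subrK. Qed.

(** [is_flow] does not contain the group law. Both sides are integral curves in [s] with the same
    value at [s = 0], so their difference vanishes. *)
Lemma flow_add s a x : M x -> Phi s (Phi a x) = Phi (s + a) x.
Proof.
move=> Mx; apply/eqP; rewrite -subr_eq0; apply/eqP.
have Ma := flow_in a Mx.
have dshift (t : R) : is_derive t 1 (fun s => Phi (s + a) x) (Y (Phi (t + a) x)).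
  have da : is_derive t 1 (fun s : R => s + a) 1.
    by apply: is_derive_eq (is_deriveD (is_derive_id t 1) (is_derive_cst a t 1)) _; rewrite addr0.
  apply: is_derive_eq (is_derive_mx_comp (h := fun s => s + a) (is_derive_flow (t + a) Mx) da) _.
  by rewrite scale1r.
have -> := curves_diff (fun t => flow_in t Ma) (fun t => flow_in (t + a) Mx)
  (fun t => is_derive_flow t Ma) dshift s.
by rewrite add0r flow0// subrr mulmx0.
Qed.

Lemma flow_diffeomorphism a : diffeomorphism_on M (Phi a).
Proof.
have smoothPhi c : smooth_on M (Phi c).
  apply: affine_on_smooth => // i j.
  (* The affine formula needs a base point in [M]; if there is none, every condition on [M] is
     vacuous. *)
  have [[x0 Mx0]|M0] := pselect (exists x, M x); last first.
    by exists 0, 0 => x Mx; exfalso; apply: M0; exists x.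
  exists ((Phi c x0 - expm A c *m x0) i j), (row i (expm A c)) => x Mx.
  rewrite /cpt (flow_affine _ Mx0 Mx) mulmxBr addrA addrAC [LHS]mxE.
  by congr (_ + _); rewrite -row_mul (ord1 j) [in RHS]mxE.
split; first exact: smoothPhi.
split; first by move=> x; exact: flow_in.
exists (Phi (- a)); split; first exact: smoothPhi.
move=> x Mx; split; first exact: flow_in.
  by rewrite flow_add// addNr flow0.
by rewrite flow_add// subrr flow0.
Qed.

End affine_flow.

Section milstein_equivariance.
Context {R : realType} {m k : nat} (M : set 'cV[R]_m) (M_open : open M).
Variables (mu : 'cV[R]_m -> 'cV[R]_m) (mu_smooth : smooth_on M mu).
Variables (sigma : 'cV[R]_m -> 'M[R]_(m, k)) (sigma_smooth : smooth_on M sigma).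
Variables (Y : 'cV[R]_m -> 'cV[R]_m) (C : 'cV[R]_m -> 'M[R]_k).
Hypothesis YC_symmetry : quasi_strong_symmetry M mu sigma Y C.
Variables (A : 'M[R]_m) (b : 'cV[R]_m).
Hypothesis YE : forall x, M x -> Y x = A *m x + b.
Variable C0 : 'M[R]_k.
Hypothesis CE : forall x, M x -> C x = C0.
Variables (Phi : R -> 'cV[R]_m -> 'cV[R]_m) (B : R -> 'cV[R]_m -> 'M[R]_k).
Hypothesis PhiB : is_generated_family M Y C Phi B.

Let flowPhi : is_flow M Y Phi. Proof. by case: PhiB. Qed.

Lemma generated_gauge x a : M x -> B a x = expm C0 a.
Proof.
move=> Mx; have [_ /(_ x Mx)[B0 dB]] := PhiB.
have dB' (t : R) : is_derive t 1 (B^~ x) (C0 *m B t x).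
  by apply: is_derive_eq (dB t) _; rewrite CE//; exact: flow_in flowPhi _ _ Mx.
by rewrite (linear_ode_unique dB') B0 mulmx1.
Qed.

Let YcptE j x : M x -> cpt Y j 0 x = b j 0 + (row j A *m x) 0 0.
Proof. by move=> Mx; rewrite /cpt YE// mxE addrC -row_mul [in RHS]mxE. Qed.

Let partialY i j x : M x -> partial i (cpt Y j 0) x = A j i.
Proof. by move=> Mx; rewrite (partial_affine M_open i (YcptE j) Mx) mxE. Qed.

Let partial2Y l i j x : M x -> partial l (partial i (cpt Y j 0)) x = 0.
Proof.
move=> Mx; rewrite (partial_affine M_open (c := A j i) (e := 0) _ _ Mx) ?mxE//.
by move=> z Mz; rewrite partialY// mul0mx mxE addr0.
Qed.

Lemma drift_equation x : M x -> jacobian_at mu x (Y x) = A *m mu x.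
Proof.
move=> Mx; have [_ [_ [_ [_ [H _]]]]] := YC_symmetry.
apply/matrixP => j o; rewrite (ord1 o) !mxE.
have /eqP := H x Mx j; rewrite subr_eq0 => /eqP ->.
rewrite /generatorL big1 ?mulr0 ?add0r; last first.
  by move=> l _; rewrite big1// => i _; rewrite big1// => i' _; rewrite partial2Y// mulr0.
by apply: eq_bigr => i _; rewrite partialY// mulrC.
Qed.

Lemma diffusion_equation x : M x ->
  jacobian_at sigma x (Y x) = A *m sigma x - sigma x *m C0.
Proof.
move=> Mx; have [_ [_ [_ [_ [_ H]]]]] := YC_symmetry.
apply/matrixP => j a; rewrite !mxE.
have := H x Mx j a; rewrite CE// => /eqP.
rewrite addr_eq0 subr_eq => /eqP ->; rewrite [LHS]addrC; congr (_ - _).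
by apply: eq_bigr => i _; rewrite partialY// mulrC.
Qed.

Lemma drift_equivariant x a : M x -> mu (Phi a x) = expm A a *m mu x.
Proof.
move=> Mx; rewrite -{2}(flow0 flowPhi Mx).
apply: (linear_ode_unique (u := fun t => mu (Phi t x))) => t.
have Mt := flow_in flowPhi t Mx.
apply: is_derive_eq (smooth_on_chain M_open mu_smooth Mt (is_derive_flow flowPhi t Mx)) _.
exact: drift_equation.
Qed.

(** The factor [e^(t C0)] is chosen so that its derivative cancels the term [- sigma C0] of the
    diffusion equation, leaving [u' = A u]. *)
Lemma diffusion_equivariant x a : M x ->
  sigma (Phi a x) *m expm C0 a = expm A a *m sigma x.
Proof.
move=> Mx; rewrite -{2}(flow0 flowPhi Mx) -[sigma (Phi 0 x)]mulmx1 -(expm0 C0).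
apply: (linear_ode_unique (u := fun t => sigma (Phi t x) *m expm C0 t)) => t.
 have Mt := flow_in flowPhi t Mx.
apply: is_derive_eq (is_derive_mulmx (smooth_on_chain M_open sigma_smooth Mt
  (is_derive_flow flowPhi t Mx)) (is_derive_expml C0 t)) _.
by rewrite diffusion_equation// mulmxBl !mulmxA subrK.
Qed.

(* Both sides are the derivative at [s = 0] of
   [s |-> sigma (Phi a (x + s *: v)) *m expm C0 a], computed with the chain rule
   and with the equivariance of [sigma]. *)
Lemma jacobian_equivariant x a v : M x ->
  jacobian_at sigma (Phi a x) (expm A a *m v) *m expm C0 a =
  expm A a *m jacobian_at sigma x v.
Proof.
move=> Mx.
have dl (w y : 'cV[R]_m) : is_derive (0 : R) 1 (fun s : R => y + s *: w) w.
  apply/is_derive_mxP => i j.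
  rewrite (_ : (fun s => _) = cst (y i j) + (fun s => s * w i j)); last first.
    by apply/funext => s; rewrite !mxE.
  have H := is_deriveD (is_derive_cst (y i j) (0 : R) 1)
    (is_deriveM (is_derive_id (0 : R) 1) (is_derive_cst (w i j) (0 : R) 1)).
  apply: is_derive_eq H _.
  by rewrite add0r scaler0 add0r [_%:A]mulr1.
have d1 : is_derive (0 : R) 1 (fun s : R => expm A a *m sigma (x + s *: v))
    (expm A a *m jacobian_at sigma x v).
  apply: is_derive_mulmxl.
  have Mx' : M (x + (0 : R) *: v) by rewrite scale0r addr0.
  have := smooth_on_chain M_open sigma_smooth Mx' (dl v x).
  by rewrite scale0r addr0.
have Mp := flow_in flowPhi a Mx.
have d2 : is_derive (0 : R) 1
    (fun s : R => sigma (Phi a x + s *: (expm A a *m v)) *m expm C0 a)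
    (jacobian_at sigma (Phi a x) (expm A a *m v) *m expm C0 a).
  have Mx' : M (Phi a x + (0 : R) *: (expm A a *m v)) by rewrite scale0r addr0.
  have H := smooth_on_chain M_open sigma_smooth Mx' (dl _ _).
  apply: is_derive_eq (is_derive_mulmx H (is_derive_cst (expm C0 a) (0 : R) 1)) _.
  by rewrite mulmx0 addr0 scale0r addr0.
have E : \forall s \near (0 : R), expm A a *m sigma (x + s *: v) =
    sigma (Phi a x + s *: (expm A a *m v)) *m expm C0 a.
  have : \forall s \near (0 : R), M (x + s *: v).
    have : (fun s : R => x + s *: v) s @[s --> (0 : R)] --> x + (0 : R) *: v.
      by apply: cvgD; [exact: cvg_cst|apply: cvgZr_tmp; exact: cvg_id].
    by rewrite scale0r addr0; apply; exact: open_nbhs_nbhs.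
  apply: filterS => s Ms.
  rewrite -(diffusion_equivariant a Ms) (flow_affine YE flowPhi a Mx Ms).
  by rewrite addrAC subrr add0r scalemxAr.
by have [_ <-] := d2; have [_ ->] := near_eq_is_derive E d1.
Qed.

Lemma milstein_equivariant x a z : M x -> M (milstein mu sigma x z) ->
  Phi a (milstein mu sigma x z) =
  milstein mu sigma (Phi a x) (gauge (expm C0 a) z).
Proof.
(* Matrix form of the scheme: the correction is a sum over the columns [c] of [sigma], each the
   derivative of [sigma] along that column, applied to row [c] of the double integrals. *)
have milE y w : milstein mu sigma y w = y + (w.1.1 *: mu y + (sigma y *m w.1.2
   + 2^-1 *: \sum_c jacobian_at sigma y (col c (sigma y)) *m col c w.2^T)).
  rewrite !addrA; apply/matrixP => i o; rewrite (ord1 o) !mxE [mu y i 0 * _]mulrC.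
  congr (_ + _ * _); rewrite summxE exchange_big/=; apply: eq_bigr => c _.
  rewrite mxE exchange_big/=; apply: eq_bigr => d _.
  by rewrite !mxE mulr_suml; apply: eq_bigr => l _; rewrite mxE.
move=> Mx Mz; rewrite (flow_affine YE flowPhi a Mx Mz) !milE/=.
rewrite drift_equivariant// mulmxA diffusion_equivariant//; congr (_ + _).
rewrite [x + _]addrC addrK !mulmxDr -scalemxAr mulmxA; congr (_ + (_ + _)).
rewrite -scalemxAr mulmx_sumr; congr (_ *: _).
set B0 := expm C0 a; set E := expm A a.
have DE : sigma (Phi a x) *m B0 = E *m sigma x by exact: diffusion_equivariant.
have jacB (w : 'cV[R]_k) : jacobian_at sigma (Phi a x) (sigma (Phi a x) *m w) =
    \sum_c w c 0 *: jacobian_at sigma (Phi a x) (col c (sigma (Phi a x))).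
  apply/matrixP => i j; rewrite summxE !mxE.
  under [RHS]eq_bigr do rewrite !mxE mulr_sumr.
  rewrite exchange_big/=; apply: eq_bigr => l _.
  by rewrite mxE mulr_suml; apply: eq_bigr => c _; rewrite mxE; ring.
have colM p q r (F : 'M[R]_(p, q)) (G : 'M[R]_(q, r)) c : col c (F *m G) = F *m col c G.
  by rewrite !colE mulmxA.
(* Column [c] of [E sigma] equals column [c] of [sigma(Phi a x) B0], a combination of the columns
   [d] of [sigma(Phi a x)] with coefficients [B0 d c]; the derivative is linear in its direction. *)
have L c : E *m (jacobian_at sigma x (col c (sigma x)) *m col c z.2^T) =
  \sum_d B0 d c *: (jacobian_at sigma (Phi a x) (col d (sigma (Phi a x))) *m
     (B0 *m col c z.2^T)).
  rewrite mulmxA -jacobian_equivariant// -/B0 -/E -(colM _ _ _ E) -DE.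
  rewrite colM jacB -mulmxA mulmx_suml; apply: eq_bigr => d _.
  by rewrite -scalemxAl mxE.
rewrite (eq_bigr _ (fun c _ => L c)) exchange_big/=; apply: eq_bigr => d _.
rewrite !trmx_mul trmxK !mulmxA colM.
(* The right factor [B0^T] of the gauged double integrals supplies the same coefficients [B0 d c],
   so the two double sums agree term by term. *)
have -> : col d B0^T = \sum_c B0 d c *: (delta_mx c 0 : 'cV[R]_k).
  apply/matrixP => i j; rewrite (ord1 j) summxE (bigD1 i)//= big1 ?addr0.
    by rewrite !mxE !eqxx mulr1.
  by move=> c ci; rewrite !mxE eq_sym (negbTE ci) mulr0.
rewrite !mulmx_sumr; apply: eq_bigr => c _.
by rewrite -!scalemxAr (colE c) !mulmxA.
Qed.

End milstein_equivariance.

(** * Rotation invariance of Gaussian vectors *)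

Section lebesgue_affine.
Context {R : realType}.
Local Notation mu := (@lebesgue_measure R).
Local Open Scope ereal_scope.

(** [|c|] times the image measure agrees with Lebesgue measure on half-open intervals, and this
    determines it. *)
Lemma lebesgue_measure_affine (c d : R) (A : set R) : c != 0%R -> measurable A ->
  mu ((fun x => c * x + d)%R @^-1` A) = (`|c|^-1)%:E * mu A.
Proof.
move=> c0 mA.
have c1 : (0 < `|c|)%R by rewrite normr_gt0.
have mf : measurable_fun [set: R] ((fun x => c * x + d)%R : R -> measurableTypeR R).
  by apply: measurable_funD => //; exact: measurable_funM.
pose f := (fun x => c * x + d)%R : R -> measurableTypeR R.
pose m := mscale (NngNum (ltW c1)) (pushforward mu f).
rewrite (_ : mu A = m mf A); last first.
  apply: lebesgue_measure_unique => //= _ [[a b] _ <-]/=.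
  rewrite /m /mscale/= /pushforward.
  (* For negative [c] the preimage of an interval open on the left is open on the right, so the two
     signs need different intervals of equal length. *)
  have [c0'|c0'|/eqP] := ltgtP c 0%R; last by rewrite (negbTE c0).
  - rewrite (_ : f @^-1` _ = `[(b - d) / c, (a - d) / c[%classic)%R.
      rewrite !lebesgue_measure_itv/= !lte_fin ltr_nM2r ?invr_lt0// ltrBlDr subrK.
      case: ifPn => _; last by rewrite mule0.
      by rewrite -!EFinD -EFinM ler0_norm ?ltW//; congr EFin; field.
    apply/seteqP; split => x/=; rewrite !in_itv/= ler_ndivrMr// ltr_ndivlMr//.
      by rewrite lerBrDr ltrBlDr mulrC andbC.
    by rewrite lerBrDr ltrBlDr mulrC andbC.
  - rewrite (_ : f @^-1` _ = `](a - d) / c, (b - d) / c]%classic)%R.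
      rewrite !lebesgue_measure_itv/= !lte_fin ltr_pM2r ?invr_gt0// ltrBlDr subrK.
      case: ifPn => _; last by rewrite mule0.
      by rewrite -!EFinD -EFinM ger0_norm ?ltW//; congr EFin; field.
    apply/seteqP; split => x/=; rewrite !in_itv/= ltr_pdivrMr// ler_pdivlMr//.
      by rewrite lerBrDr ltrBlDr mulrC.
    by rewrite lerBrDr ltrBlDr mulrC.
by rewrite /m /mscale/= muleA -EFinM mulVf ?mul1e// gt_eqF.
Qed.

Lemma ge0_integral_affine (c d : R) (f : R -> \bar R) : c != 0%R ->
  measurable_fun setT f -> (forall x, 0 <= f x) ->
  \int[mu]_x f (c * x + d)%R = (`|c|^-1)%:E * \int[mu]_x f x.
Proof.
move=> c0 mf f0.
have c1 : (0 <= `|c|^-1)%R by rewrite invr_ge0.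
have mg : measurable_fun [set: measurableTypeR R]
    ((fun x => c * x + d)%R : measurableTypeR R -> measurableTypeR R).
  by apply: measurable_funD => //; exact: measurable_funM.
pose m := mscale (NngNum c1) mu.
have -> : (`|c|^-1)%:E * \int[mu]_x f x = \int[m]_x f x.
  by rewrite ge0_integral_mscale.
rewrite -[LHS]/(\int[mu]_(x in (fun x => c * x + d)%R @^-1` setT) (f \o (fun x => c * x + d)%R) x).
rewrite -(ge0_integral_pushforward mg mu measurableT mf) //.
by apply: eq_measure_integral => A mA _; exact: lebesgue_measure_affine.
Qed.


(* Two one-dimensional affine substitutions and Tonelli's theorem: for [c != 0]
   first [u = c x - s y] at fixed [y], then [v = (s u + y) / c] at fixed [u]. *)
Lemma lebesgue_rotation (c s : R) (g : measurableTypeR R * measurableTypeR R -> \bar R) :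
  (c ^+ 2 + s ^+ 2 = 1)%R -> measurable_fun setT g -> (forall z, 0 <= g z) ->
  \int[mu]_x \int[mu]_y g (c * x - s * y, s * x + c * y)%R =
  \int[mu]_x \int[mu]_y g (x, y).
Proof.
move=> cs mg g0.
have m_aff (a b a' b' : R) : measurable_fun setT
    (fun z : measurableTypeR R * measurableTypeR R => g (a * z.1 + b * z.2, a' * z.1 + b' * z.2)%R).
  apply: (measurableT_comp mg); apply/measurable_fun_pairP; split.
    by apply: measurable_funD; apply: measurable_funM.
  by apply: measurable_funD; apply: measurable_funM.
(* Here [|s| = 1] and the rotation merely exchanges the coordinates up to sign. *)
have [c0|c0] := eqVneq c 0%R.
  have s0 : s != 0%R.
    by apply: contraTneq (oner_neq0 R) => s0; rewrite -cs c0 s0 !expr0n addr0 eqxx.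
  have s1 : `|s|%R = 1%R.
    apply/eqP; rewrite -(@eqrXn2 _ 2) ?normr_ge0// expr1n real_normK ?num_real//.
    by rewrite -cs c0 expr0n add0r.
  transitivity (\int[mu]_x \int[mu]_y g (y, s * x)%R).
    apply: eq_integral => x _.
    rewrite (_ : (fun y => _) = (fun y => g (- s * y + 0, s * x)%R)); last first.
      by apply/funext => y; rewrite c0 !mul0r sub0r !addr0 mulNr.
    rewrite (ge0_integral_affine _ (f := fun y => g (y, s * x)%R)) ?oppr_eq0//.
      by rewrite normrN s1 invr1 mul1e.
    exact: measurableT_comp.
  have mk : measurable_fun setT (fun z : measurableTypeR R * measurableTypeR R =>
      g (z.2, s * z.1)%R).
    have := m_aff 0%R 1%R s 0%R.
    by congr measurable_fun; apply/funext => z; rewrite !mul0r add0r addr0 mul1r.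
  transitivity (\int[mu]_y \int[mu]_x g (y, s * x)%R).
    exact: (fubini_tonelli (m1 := mu) (m2 := mu) _ mk (fun=> g0 _)).
  apply: eq_integral => y _ /=.
  rewrite (_ : (fun x => _) = (fun x => g (y, s * x + 0)%R)); last first.
    by apply/funext => x; rewrite addr0.
  rewrite (ge0_integral_affine _ (f := fun x => g (y, x)))//.
    by rewrite s1 invr1 mul1e.
  exact: measurableT_comp.
have c1 : (0 <= `|c|^-1)%R by rewrite invr_ge0.
have mh : measurable_fun setT (fun z : measurableTypeR R * measurableTypeR R =>
     g (z.1, s / c * z.1 + c^-1 * z.2)%R).
  have := m_aff 1%R 0%R (s / c)%R c^-1%R.
  by congr measurable_fun; apply/funext => z; rewrite mul1r mul0r addr0.
have mk : measurable_fun setT (fun z : measurableTypeR R * measurableTypeR R =>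
    g (c * z.1 - s * z.2, s * z.1 + c * z.2)%R).
  have := m_aff c (- s)%R s c.
  by congr measurable_fun; apply/funext => z; rewrite mulNr.
transitivity (\int[mu]_y \int[mu]_x g (c * x - s * y, s * x + c * y)%R).
  exact: (fubini_tonelli (m1 := mu) (m2 := mu) _ mk (fun=> g0 _)).
transitivity (\int[mu]_y ((`|c|^-1)%:E * \int[mu]_u g (u, s / c * u + c^-1 * y)%R)).
  apply: eq_integral => y _ /=.
  rewrite -(ge0_integral_affine (- (s * y)) (f := fun u => g (u, s / c * u + c^-1 * y)%R))//.
    apply: eq_integral => x _; congr (g (_, _)).
    have -> : (c^-1 * y = (c ^+ 2 + s ^+ 2) * (c^-1 * y))%R by rewrite cs mul1r.
    by field.
  exact: (measurable_fun_pair1 y mh).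
rewrite ge0_integralZl//=; first last.
- by move=> y _; exact: integral_ge0.
- exact: (measurable_fun_fubini_tonelli_G (m1 := mu) _ mh).
rewrite -(fubini_tonelli (m1 := mu) (m2 := mu)
  (fun z : measurableTypeR R * measurableTypeR R => g (z.1, s / c * z.1 + c^-1 * z.2)%R))//=.
rewrite -ge0_integralZl//=; first last.
- by move=> y _; exact: integral_ge0.
- exact: (measurable_fun_fubini_tonelli_F (m2 := mu) _ mh).
apply: eq_integral => u _.
under eq_integral => y _ do rewrite addrC.
rewrite (ge0_integral_affine _ (f := fun v => g (u, v)))// ?invr_eq0//.
  by rewrite muleA -EFinM normfV invrK mulVf ?mul1e// normr_eq0.
exact: measurableT_comp.
Qed.

End lebesgue_affine.

(** * The Gaussian measure of the plane *)

Section gauss2.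
Context {R : realType}.
Variables (sd : R) (sd0 : sd != 0).
Local Notation mu := (@lebesgue_measure R).
Local Notation N := (normal_prob 0 sd).
Local Notation p := (normal_pdf 0 sd).
Local Notation T := (measurableTypeR R).
Local Open Scope ereal_scope.

Lemma normal_prob_opp (E : set R) : measurable E -> N (-%R @^-1` E) = N E.
Proof.
move=> mE.
have mp : measurable_fun setT ((EFin \o p) \_ E).
  apply/(measurable_restrictT _ mE).
  by apply/measurable_funTS/measurable_EFinP; exact: measurable_normal_pdf.
rewrite /normal_prob integral_mkcond [RHS]integral_mkcond.
transitivity ((`|(-1 : R)|^-1)%:E * \int[mu]_x ((EFin \o p) \_ E) x)%E; last first.
  by rewrite normrN1 invr1 mul1e.
have p0 x : 0 <= ((EFin \o p) \_ E) x.
  by rewrite /patch; case: ifP => //= _; rewrite lee_fin normal_pdf_ge0.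
have N1 : (-1 : R)%R != 0%R by rewrite oppr_eq0 oner_eq0.
rewrite -[RHS](ge0_integral_affine 0%R N1 mp p0).
apply: eq_integral => x _; rewrite mulN1r addr0 /patch.
have -> : (x \in -%R @^-1` E) = ((- x)%R \in E) by apply/idP/idP; rewrite !inE.
case: ifP => // _ /=; congr EFin.
by rewrite !normal_pdfE//= /normal_fun !subr0 sqrrN.
Qed.

Let h (z : T * T) : \bar R := (p z.1 * p z.2)%:E.

Let mh : measurable_fun setT h.
Proof.
apply/measurable_EFinP; apply: measurable_funM.
  exact: (measurableT_comp (measurable_normal_pdf 0%R sd) measurable_fst).
exact: (measurableT_comp (measurable_normal_pdf 0%R sd) measurable_snd).
Qed.

Let h0 z : 0 <= h z.
Proof. by rewrite lee_fin mulr_ge0// normal_pdf_ge0. Qed.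

(** The product of two centred normal laws, given by its density: rectangles are easy in product
    form, rotations in density form. *)
Let nu (S : set (T * T)) := \int[(mu \x mu)]_(z in S) h z.

Let nu_set0 : nu set0 = 0. Proof. exact: integral_set0. Qed.
Let nu_ge0 S : 0 <= nu S. Proof. exact: integral_ge0. Qed.
Let nu_additive : semi_sigma_additive nu.
Proof. exact: semi_sigma_additive_nng_induced. Qed.

HB.instance Definition _ := isMeasure.Build _ _ _ nu nu_set0 nu_ge0 nu_additive.

Let mhS S : measurable S -> measurable_fun setT (h \_ S).
Proof. by move=> mS; apply/(measurable_restrictT _ mS)/measurable_funTS. Qed.

Let hS0 S z : 0 <= (h \_ S) z.
Proof. by rewrite /patch; case: ifP. Qed.

Let nuE S : measurable S -> nu S = \int[mu]_x \int[mu]_y (h \_ S) (x, y).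
Proof.
move=> mS; rewrite /nu integral_mkcond; exact: (fubini_tonelli1 _ (mhS mS)).
Qed.

Let nu_rect (E F : set R) : measurable E -> measurable F ->
  nu (E `*` F) = N E * N F.
Proof.
move=> mE mF; rewrite nuE; last exact: measurableX.
have mp (D : set R) : measurable D -> measurable_fun setT ((EFin \o p) \_ D).
  move=> mD; apply/(measurable_restrictT _ mD).
  by apply/measurable_funTS/measurable_EFinP; exact: measurable_normal_pdf.
have p0 (D : set R) x : 0 <= ((EFin \o p) \_ D) x.
  by rewrite /patch; case: ifP => //= _; rewrite lee_fin normal_pdf_ge0.
transitivity (\int[mu]_x (((EFin \o p) \_ E) x * N F)).
  apply: eq_integral => x _.
  rewrite /normal_prob [X in _ = _ * X]integral_mkcond -ge0_integralZl//; last exact: mp.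
  apply: eq_integral => y _; rewrite /patch in_setX/=.
  by case: (x \in E); case: (y \in F) => /=; rewrite ?mule0 ?mul0e.
rewrite ge0_integralZr//; last exact: mp.
by rewrite -integral_mkcond.
Qed.

Let nu_rot (c s : R) (E F : set R) : (c ^+ 2 + s ^+ 2 = 1)%R ->
  measurable E -> measurable F ->
  measurable [set z : T * T | E (c * z.1 - s * z.2)%R /\ F (s * z.1 + c * z.2)%R] ->
  nu [set z : T * T | E (c * z.1 - s * z.2)%R /\ F (s * z.1 + c * z.2)%R] = nu (E `*` F).
Proof.
move=> cs mE mF mS; rewrite (nuE mS) (nuE (measurableX mE mF)).
rewrite -[RHS](lebesgue_rotation cs (mhS (measurableX mE mF)) (hS0 _)).
apply: eq_integral => x _; apply: eq_integral => y _; rewrite /patch.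
have -> : ((x, y) \in [set z : T * T | E (c * z.1 - s * z.2)%R /\ F (s * z.1 + c * z.2)%R])
   = ((c * x - s * y, s * x + c * y)%R \in E `*` F) by apply/idP/idP; rewrite !inE.
case: ifP => // _; rewrite /h/=; congr EFin.
rewrite !normal_pdfE// /normal_fun !subr0.
rewrite mulrACA [RHS]mulrACA -!expRD; congr (_ * expR _)%R.
rewrite -!mulrDl -!opprD; congr (- _ / _)%R.
have -> : (x ^+ 2 + y ^+ 2 = (c ^+ 2 + s ^+ 2) * (x ^+ 2 + y ^+ 2))%R by rewrite cs mul1r.
by ring.
Qed.

Lemma measurable_rot (c s : R) (E F : set R) : measurable E -> measurable F ->
  measurable [set z : T * T | E (c * z.1 - s * z.2)%R /\ F (s * z.1 + c * z.2)%R].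
Proof.
move=> mE mF.
have m_aff (a b : R) : measurable_fun setT (fun z : T * T => (a * z.1 + b * z.2)%R).
  by apply: measurable_funD; apply: measurable_funM.
rewrite (_ : [set _ | _] =
  (fun z : T * T => (c * z.1 + (- s) * z.2)%R) @^-1` E `&`
  (fun z : T * T => (s * z.1 + c * z.2)%R) @^-1` F); last first.
  by apply/seteqP; split => z/=; rewrite mulNr.
by apply: measurableI; rewrite -[X in measurable X]setTI; apply: m_aff.
Qed.

(** The rotated set is not a rectangle, so [Q] is first identified with [K] times the Gaussian
    measure on all measurable sets, by uniqueness from rectangles. The mass [K] leaves room for the
    law of two coordinates restricted to an event about the others. *)
Lemma gauss_rotation (c s : R) (Q : {measure set (T * T) -> \bar R}) (K : R) :
  (c ^+ 2 + s ^+ 2 = 1)%R -> (0 <= K)%R ->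
  (forall E F, measurable E -> measurable F -> Q (E `*` F) = K%:E * (N E * N F)) ->
  forall E F, measurable E -> measurable F ->
  Q [set z | E (c * z.1 - s * z.2)%R /\ F (s * z.1 + c * z.2)%R] = K%:E * (N E * N F).
Proof.
move=> cs K0 QE E F mE mF.
have mS := measurable_rot c s mE mF.
rewrite -nu_rect// -(nu_rot cs)//.
pose m := mscale (NngNum K0) nu.
apply: (@measure_unique _ R (T * T)%type
  [set A `*` B | A in measurable & B in measurable] (fun=> setT) _ _ _ _ Q m) => //.
- by rewrite measurable_prod_measurableType.
- move=> _ _ [A1 mA1 [B1 mB1 <-]] [A2 mA2 [B2 mB2 <-]].
  exists (A1 `&` A2); first exact: measurableI.
  by exists (B1 `&` B2); [exact: measurableI|rewrite setXI].
- by move=> _; exists setT => //; exists setT => //; rewrite setXTT.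
- by apply/seteqP; split => // z _; exists 0%N.
- by move=> _ [A mA [B mB <-]]; rewrite QE// -nu_rect.
- move=> _; rewrite -setXTT QE//= !probability_setT !mule1 ltry//.
Qed.

End gauss2.

(** * Orthogonal matrices as products of plane rotations and reflections *)

Section row_operations.
Context {R : realType} {k : nat}.

(** Left multiplication by a Givens rotation. Allowing any number of columns lets it act on the
    matrix being reduced and on random vectors alike. *)
Definition rotate_rows (p q : 'I_k) (c s : R) n (X : 'M[R]_(k, n)) : 'M[R]_(k, n) :=
  \matrix_(i, j) if i == p then c * X p j - s * X q j
                 else if i == q then s * X p j + c * X q j else X i j.

Definition flip_row (p : 'I_k) n (X : 'M[R]_(k, n)) : 'M[R]_(k, n) :=
  \matrix_(i, j) if i == p then - X p j else X i j.

Lemma rotate_rows_mul p q c s n r (X : 'M[R]_(k, n)) (Z : 'M[R]_(n, r)) :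
  rotate_rows p q c s X *m Z = rotate_rows p q c s (X *m Z).
Proof.
apply/matrixP => i j; rewrite !mxE; under eq_bigr do rewrite mxE.
case: ifP => _.
  rewrite !mulr_sumr -sumrB; apply: eq_bigr => l _.
  by rewrite mulrBl !mulrA.
case: ifP => _ //.
rewrite !mulr_sumr -big_split/=; apply: eq_bigr => l _.
by rewrite mulrDl !mulrA.
Qed.

Lemma flip_row_mul p n r (X : 'M[R]_(k, n)) (Z : 'M[R]_(n, r)) :
  flip_row p X *m Z = flip_row p (X *m Z).
Proof.
apply/matrixP => i j; rewrite !mxE; under eq_bigr do rewrite mxE.
case: ifP => _ //.
by rewrite -sumrN; apply: eq_bigr => l _; rewrite mulNr.
Qed.

Lemma rotate_rowsK p q c s n (X : 'M[R]_(k, n)) : p != q -> c ^+ 2 + s ^+ 2 = 1 ->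
  rotate_rows p q c s (rotate_rows p q c (- s) X) = X.
Proof.
move=> pq cs; have qp : (q == p) = false by rewrite eq_sym (negbTE pq).
apply/matrixP => i j; rewrite !mxE !eqxx qp.
case: eqP => [->|_].
  by rewrite -[RHS]mul1r -cs; ring.
case: eqP => [->|_] //.
by rewrite -[RHS]mul1r -cs; ring.
Qed.

Lemma flip_rowK p n (X : 'M[R]_(k, n)) : flip_row p (flip_row p X) = X.
Proof.
by apply/matrixP => i j; rewrite !mxE eqxx; case: eqP => [->|_] //; rewrite opprK.
Qed.

Lemma rotate_rows_gram p q c s n (X : 'M[R]_(k, n)) : p != q -> c ^+ 2 + s ^+ 2 = 1 ->
  (rotate_rows p q c s X)^T *m rotate_rows p q c s X = X^T *m X.
Proof.
move=> pq cs; have qp : (q == p) = false by rewrite eq_sym (negbTE pq).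
apply/matrixP => i j; rewrite !mxE.
rewrite (bigD1 p)//= (bigD1 q) 1?eq_sym//= [RHS](bigD1 p)//= [in RHS](bigD1 q) 1?eq_sym//=.
rewrite !addrA; congr (_ + _).
  rewrite !mxE !eqxx qp -[RHS]mul1r -cs; ring.
by apply: eq_bigr => l /andP[lp lq]; rewrite !mxE (negbTE lp) (negbTE lq).
Qed.

Lemma flip_row_gram p n (X : 'M[R]_(k, n)) :
  (flip_row p X)^T *m flip_row p X = X^T *m X.
Proof.
apply/matrixP => i j; rewrite !mxE; apply: eq_bigr => l _; rewrite !mxE.
by case: eqP => [->|_] //; rewrite mulrNN.
Qed.

(* Givens elimination clears the columns of [B] one after the other. *)
Lemma orthogonal_ind (G : 'M[R]_k -> Prop) :
  G 1%:M ->
  (forall p q c s B, p != q -> c ^+ 2 + s ^+ 2 = 1 -> G B -> G (rotate_rows p q c s B)) ->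
  (forall p B, G B -> G (flip_row p B)) ->
  forall B, B^T *m B = 1%:M -> G B.
Proof.
move=> G1 Grot Gflip.
(* [fixes j B] says that the first [j] columns are those of the identity. The outer induction is on
   the number [e] of remaining columns, the inner one on the number of nonzero entries below the
   diagonal in column [j]. *)
pose fixes j (B : 'M[R]_k) := forall i l : 'I_k, (i < j)%N -> B l i = (l == i)%:R.
suff H : forall e j, (j + e = k)%N -> forall B, B^T *m B = 1%:M -> fixes j B -> G B.
  by move=> B oB; apply: (H k 0%N _ B oB).
elim=> [j|e IH j].
  rewrite addn0 => jk B _ fB; suff -> : B = 1%:M by [].
  by apply/matrixP => l i; rewrite mxE fB// jk.
rewrite addnS => jk; have jk' : (j < k)%N by rewrite -jk ltnS leq_addr.
pose o := Ordinal jk'.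
pose nz (B : 'M[R]_k) := [pred q : 'I_k | (j < q)%N && (B q o != 0)].
suff H : forall n B, (#|nz B| <= n)%N -> B^T *m B = 1%:M -> fixes j B -> G B.
  by move=> B; apply: (H #|nz B|).
(* Entries above the diagonal vanish for free: column [o] is orthogonal to the first [j] basis
   vectors. *)
have col0 (B : 'M[R]_k) : B^T *m B = 1%:M -> fixes j B ->
    forall q : 'I_k, (q < j)%N -> B q o = 0.
  move=> /matrixP oB fB q qj; have := oB q o; rewrite !mxE (bigD1 q)//= big1.
    by rewrite mxE fB// eqxx mul1r addr0 -val_eqE/= ltn_eqF.
  by move=> l lq; rewrite mxE fB// (negbTE lq) mul0r.
elim=> [|n IHn] B.
  rewrite leqn0 => /eqP/card0_eq nz0 oB fB.
  have Bo q : q != o -> B q o = 0.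
    rewrite -val_eqE/= neq_ltn => /orP[|jq]; first exact: col0.
    apply/eqP; have := nz0 q.
    by rewrite !inE jq/= => /negbFE.
  (* Only the diagonal entry is left in a column of norm 1, so it is 1 or -1; a reflection repairs
     the sign. *)
  have : B o o ^+ 2 == 1.
    move/matrixP: oB => /(_ o o); rewrite !mxE (bigD1 o)//= big1 ?addr0.
      by rewrite mxE eqxx expr2 => ->.
    by move=> l lo; rewrite (Bo l)// mulr0.
  have next X : X^T *m X = 1%:M -> fixes j X -> (forall q, q != o -> X q o = 0) ->
      X o o = 1 -> G X.
    move=> oX fX Xo Xoo; apply: (IH j.+1 _ X oX); first by rewrite addSn.
    move=> i l; rewrite ltnS leq_eqVlt => /orP[/eqP ij|]; last exact: fX.
    have -> : i = o by exact: val_inj.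
    by case: eqVneq => [->|/Xo].
  rewrite sqrf_eq1 => /orP[/eqP|/eqP] Boo; first exact: next.
  rewrite -(flip_rowK o B); apply: Gflip; apply: next.
  - by rewrite flip_row_gram.
  - move=> i l ij; rewrite mxE; case: eqP => [->|_]; last exact: fB.
    by rewrite fB// -val_eqE/= gtn_eqF// oppr0.
  - by move=> q qo; rewrite mxE (negbTE qo) Bo.
  - by rewrite mxE eqxx Boo opprK.
move=> nzn oB fB.
have [q /andP[jq Bq]|nz0] := pickP (nz B); last first.
  by apply: IHn => //; rewrite (eq_card0 nz0).
have oq : o != q by rewrite -val_eqE/= ltn_eqF.
(* The rotation by [(c, - s)] annihilates the entry [(q, o)], since [- s * B o o + c * B q o = 0];
   applying [(c, s)] to the result recovers [B]. *)
pose r := Num.sqrt (B o o ^+ 2 + B q o ^+ 2).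
have r2 : r ^+ 2 = B o o ^+ 2 + B q o ^+ 2.
  by rewrite sqr_sqrtr// addr_ge0 ?sqr_ge0.
have r0 : r != 0.
  by rewrite -sqrf_eq0 r2 gt_eqF// ltr_wpDl ?sqr_ge0// exprn_even_gt0.
pose c := B o o / r; pose s := B q o / r.
have cs : c ^+ 2 + s ^+ 2 = 1.
  by rewrite !expr_div_n -mulrDl -r2 divff// sqrf_eq0.
have cs' : c ^+ 2 + (- s) ^+ 2 = 1 by rewrite sqrrN.
rewrite -(rotate_rowsK B oq cs); apply: Grot => //; apply: IHn.
- have qnz : q \in nz B by rewrite inE jq.
  rewrite -ltnS (leq_trans _ nzn)// proper_card//.
  apply/properP; split.
    apply/fintype.subsetP => l; rewrite !inE => /andP[jl]; rewrite jl/= !mxE.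
    have lo : l != o by rewrite -val_eqE/= gtn_eqF.
    rewrite (negbTE lo); by case: (l =P q) => [->|//]; rewrite Bq.
  exists q => //; rewrite !inE jq/= !mxE eqxx (eq_sym q) (negbTE oq) negbK.
  by apply/eqP; rewrite /s /c; ring.
- by rewrite rotate_rows_gram.
- move=> i l ij; rewrite mxE.
  have oi : o != i by rewrite -val_eqE/= gtn_eqF.
  have qi : q != i by rewrite -val_eqE/= gtn_eqF// (ltn_trans ij).
  case: eqP => [->|_].
    by rewrite !fB// (negbTE oi) (negbTE qi) !mulr0 subr0.
  case: eqP => [->|_]; last exact: fB.
  by rewrite !fB// (negbTE oi) (negbTE qi) !mulr0 addr0.
Qed.

End row_operations.

Section gaussian_vector.
Context {R : realType} {k : nat} d (Omega : measurableType d) (P : probability Omega R).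
Variables (sd : R) (sd0 : sd != 0) (A : set Omega) (mA : measurable A).
Local Notation N := (normal_prob 0 sd).

(* Conditionally on [A], the vector [V] has law N(0, sd ^ 2 I). *)
Definition gaussian_on (V : Omega -> 'cV[R]_k) :=
  (forall a, measurable_fun setT (fun w => V w a 0)) /\
  forall E : 'I_k -> set R, (forall a, measurable (E a)) ->
    P (A `&` [set w | forall a, E a (V w a 0)]) =
    (P A * \big[*%E/1%E]_(a < k) N (E a))%E.

Lemma gaussian_on_flip V p : gaussian_on V -> gaussian_on (fun w => flip_row p (V w)).
Proof.
move=> [mV gV]; split => [a|E mE].
  have [->|ap] := eqVneq a p.
    rewrite (_ : (fun w => _) = (\- (fun w => V w p 0))); first exact: measurable_funN.
    by apply/funext => w; rewrite mxE eqxx.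
  rewrite (_ : (fun w => _) = (fun w => V w a 0)); first exact: mV.
  by apply/funext => w; rewrite mxE (negbTE ap).
pose E' a := if a == p then -%R @^-1` E p else E a.
have mE' a : measurable (E' a).
  rewrite /E'; case: ifP => // _.
  by rewrite -[X in measurable X]setTI; exact: oppr_measurable.
have -> : [set w | forall a, E a (flip_row p (V w) a 0)] = [set w | forall a, E' a (V w a 0)].
  by apply/seteqP; split => w /= H a; have := H a; rewrite mxE /E'; case: eqP => [->|].
rewrite gV//; congr (_ * _)%E; apply: eq_bigr => a _; rewrite /E'.
by case: eqP => [->|//]; rewrite normal_prob_opp.
Qed.

Lemma gaussian_on_rotate V p q c s : p != q -> c ^+ 2 + s ^+ 2 = 1 ->
  gaussian_on V -> gaussian_on (fun w => rotate_rows p q c s (V w)).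
Proof.
move=> pq cs [mV gV]; split => [a|E mE].
  have [->|ap] := eqVneq a p.
    rewrite (_ : (fun w => _) = (fun w => c * V w p 0 - s * V w q 0)).
      by apply: measurable_funB; apply: measurable_funM.
    by apply/funext => w; rewrite mxE eqxx.
  have [->|aq] := eqVneq a q.
    rewrite (_ : (fun w => _) = (fun w => s * V w p 0 + c * V w q 0)).
      by apply: measurable_funD; apply: measurable_funM.
    by apply/funext => w; rewrite mxE (eq_sym q) (negbTE pq) eqxx.
  rewrite (_ : (fun w => _) = (fun w => V w a 0)); first exact: mV.
  by apply/funext => w; rewrite mxE (negbTE ap) (negbTE aq).
(* The event about the coordinates other than [p] and [q] joins the conditioning. Under it the pair
   [(V p, V q)] has a law of mass [K] that factors on rectangles. *)
pose A' := A `&` [set w | forall a, a != p -> a != q -> E a (V w a 0)].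
have mbox (r : set 'I_k) : measurable [set w | forall a, r a -> E a (V w a 0)].
  apply: (@fin_bigcap_measurable _ _ _ r (fun a => (fun w => V w a 0) @^-1` E a)) => //.
  by move=> a _; rewrite -[X in measurable X]setTI; exact: mV.
have mA' : measurable A'.
  apply: measurableI => //.
  rewrite (_ : [set w | _] = [set w | forall a, [set a | (a != p) && (a != q)] a -> E a (V w a 0)]).
    exact: mbox.
  apply/seteqP; split => w /= H a; first by move=> /andP[]; exact: H.
  by move=> ap aq; apply: H; rewrite ap aq.
pose Vpq (w : Omega) : measurableTypeR R * measurableTypeR R := (V w p 0, V w q 0).
have mpq : measurable_fun [set: Omega] Vpq.
  by apply: measurable_fun_pair; exact: mV.
pose Q := pushforward (mrestr P mA') Vpq.
pose K := (P A * \big[*%E/1%E]_(a < k | (a != p) && (a != q)) N (E a))%E.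
have K0 : (0 <= K)%E.
  rewrite mule_ge0//; elim/big_rec: _ => // a x _ x0.
  by rewrite mule_ge0// measure_ge0.
have Kfin : K \is a fin_num.
  rewrite fin_numM//; first exact: fin_num_measure.
  apply: (big_rec (fun x => x \is a fin_num)) => // a x _ xf; rewrite fin_numM//.
  exact: (fin_num_measure (normal_prob 0 sd) _ (mE a)).
have qp : (q == p) = false by rewrite eq_sym (negbTE pq).
have splitpq (f : 'I_k -> \bar R) : (\big[*%E/1%E]_(a < k) f a =
    (f p * f q) * \big[*%E/1%E]_(a < k | (a != p) && (a != q)) f a)%E.
  by rewrite (bigD1 p)//= (bigD1 q) ?qp//= muleA.
have QE E1 E2 : measurable E1 -> measurable E2 ->
    Q (E1 `*` E2) = ((fine K)%:E * (N E1 * N E2))%E.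
  move=> mE1 mE2; rewrite fineK//.
  pose E' a := if a == p then E1 else if a == q then E2 else E a.
  have mE' a : measurable (E' a).
    by rewrite /E'; case: (a == p); [exact: mE1|case: (a == q); [exact: mE2|exact: mE]].
  transitivity (P (A `&` [set w | forall a, E' a (V w a 0)])).
    rewrite /Q /pushforward /mrestr/=; congr (P _); apply/seteqP; split => w /=.
      move=> [[E1w E2w] [Aw Ew]]; split=> // a; rewrite /E'.
      case: eqP => [->//|/eqP ap]; case: eqP => [->//|/eqP aq]; exact: Ew.
    move=> [Aw E'w]; split; first split.
    - by have := E'w p; rewrite /E' eqxx.
    - by have := E'w q; rewrite /E' qp eqxx.
    split=> // a ap aq; have := E'w a.
    by rewrite /E' (negbTE ap) (negbTE aq).
  rewrite gV// splitpq /K /E' eqxx qp eqxx.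
  under [X in (_ * (_ * X) = _)%E]eq_bigr => a /andP[/negbTE-> /negbTE->] do [].
  by rewrite -[RHS]muleA [X in _ = (_ * X)%E]muleC.
transitivity (Q [set z | E p (c * z.1 - s * z.2) /\ E q (s * z.1 + c * z.2)]).
  rewrite /Q /pushforward /mrestr/=; congr (P _); apply/seteqP; split => w /=.
    move=> [Aw Ew]; split; first split.
    - by have := Ew p; rewrite mxE eqxx.
    - by have := Ew q; rewrite mxE qp eqxx.
    by split=> // a ap aq; have := Ew a; rewrite mxE (negbTE ap) (negbTE aq).
  move=> [[Ep Eq] [Aw Ew]]; split => // a; rewrite mxE.
  case: eqP => [->//|/eqP ap]; case: eqP => [->//|/eqP aq]; exact: Ew.
transitivity ((fine K)%:E * (N (E p) * N (E q)))%E.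
  exact: (gauss_rotation sd0 cs (fine_ge0 K0) QE (mE p) (mE q)).
rewrite fineK// splitpq /K.
by rewrite -[LHS]muleA [X in (_ * X)%E = _]muleC.
Qed.

Lemma gaussian_on_orthogonal V B : B^T *m B = 1%:M -> gaussian_on V ->
  gaussian_on (fun w => B *m V w).
Proof.
move=> oB gV; apply: (orthogonal_ind
  (G := fun B => gaussian_on (fun w => B *m V w)) _ _ _ oB) => [|p q c s B' pq cs|p B'].
- by under eq_fun do rewrite mul1mx.
- move=> /(gaussian_on_rotate pq cs).
  by under eq_fun do rewrite -rotate_rows_mul.
- move=> /(gaussian_on_flip p).
  by under eq_fun do rewrite -flip_row_mul.
Qed.

End gaussian_vector.

(** * Equality in law *)

Section tuple_law.
Context {R : realType} {n : nat}.

(** These boxes are stable under intersection and generate the Borel sets. The strict inequality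
    makes each one an increasing union of boxes with lowered bounds, which the passage to the limit
    relies on. *)
Definition lower_box (c : 'I_n -> R) : set (n.-tuple R) :=
  [set x | forall i, tnth x i < c i].

Lemma measurable_tuple_lower_box :
  @measurable _ (n.-tuple R) = <<s range lower_box >>.
Proof.
apply/seteqP; split; last first.
  apply: smallest_sub; first exact: sigma_algebra_measurable.
  move=> _ [c _ <-].
  rewrite (_ : lower_box c = \bigcap_(i in setT) ((fun x => tnth x i) @^-1` `]-oo, c i[%classic)).
    apply: fin_bigcap_measurable => // i _; rewrite -[X in measurable X]setTI.
    exact: measurable_tnth.
  apply/seteqP; split => x /= H i; first by move=> _; rewrite /= in_itv/=.
  by have := H i I; rewrite /= in_itv.
apply: smallest_sub; first exact: smallest_sigma_algebra.
move=> A; rewrite -bigcup_seq/= => -[i _ [Y mY <-]].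
suff : measurable_fun setT ((fun x => tnth x i) : g_sigma_algebraType (range lower_box) -> R).
  by move=> /(_ measurableT Y mY).
apply: (measurability (@RGenInftyO.G R)).
  exact: RGenInftyO.measurableE.
move=> _ [_ [c ->] <-]; rewrite setTI.
(* A half-space in coordinate [i] is the union over [m] of the boxes bounded by [m] in the other
   coordinates. *)
pose u m (j : 'I_n) : R := if j == i then c else m%:R.
rewrite (_ : _ @^-1` _ = \bigcup_m lower_box (u m)).
  by apply: bigcupT_measurable => m; apply: sub_sigma_algebra; exists (u m).
apply/seteqP; split => x /=.
  rewrite in_itv/= => xc; exists (Num.trunc (\sum_j `|tnth x j|)).+1 => // j.
  rewrite /u; case: eqP => [->//|_].
  apply: le_lt_trans (truncnS_gt _); rewrite (le_trans (ler_norm _))//.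
  by rewrite (bigD1 j)//= lerDl sumr_ge0.
by move=> [m _ /(_ i)]; rewrite /u eqxx in_itv.
Qed.

Lemma tuple_measure_unique (m1 m2 : {measure set (n.-tuple R) -> \bar R}) :
  (m1 setT < +oo)%E ->
  (forall c, m1 (lower_box c) = m2 (lower_box c)) ->
  forall A, measurable A -> m1 A = m2 A.
Proof.
move=> m1oo H.
have mbox c : measurable (lower_box c).
  by rewrite measurable_tuple_lower_box; apply: sub_sigma_algebra; exists c.
apply: (@measure_unique _ R _ (range lower_box) (fun m => lower_box (fun=> m%:R))).
- exact: measurable_tuple_lower_box.
- move=> _ _ [c _ <-] [c' _ <-]; exists (fun i => Num.min (c i) (c' i)) => //.
  apply/seteqP; split => x /=.
    by move=> xc; split => i; have := xc i; rewrite lt_min => /andP[].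
  by move=> [xc xc'] i; rewrite lt_min xc xc'.
- by move=> m; exists (fun=> m%:R).
- apply/seteqP; split => // x _; exists (Num.trunc (\sum_j `|tnth x j|)).+1 => // j.
  apply: le_lt_trans (truncnS_gt _); rewrite (le_trans (ler_norm _))//.
  by rewrite (bigD1 j)//= lerDl sumr_ge0.
- by move=> _ [c _ <-].
- by move=> m; apply: le_lt_trans m1oo; apply: le_measure; rewrite ?inE.
Qed.

End tuple_law.

Section family_law.
Context {R : realType} d1 (Omega1 : measurableType d1) (P1 : probability Omega1 R)
  d2 (Omega2 : measurableType d2) (P2 : probability Omega2 R).

Definition eq_family_law (I : finType) (V1 : I -> Omega1 -> R) (V2 : I -> Omega2 -> R) :=
  forall E : I -> set R, (forall i, measurable (E i)) ->
    P1 [set w | forall i, E i (V1 i w)] = P2 [set w | forall i, E i (V2 i w)].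

(** Turns a family over a finite type into a tuple, whose measurable sets are generated by the
    coordinates. *)
Definition family_tuple (I : finType) T (V : I -> T -> R) (w : T) : #|I|.-tuple R :=
  [tuple V (enum_val i) w | i < #|I|].

Lemma tnth_family_tuple (I : finType) T (V : I -> T -> R) w i :
  tnth (family_tuple V w) (enum_rank i) = V i w.
Proof. by rewrite tnth_mktuple enum_rankK. Qed.

Lemma measurable_family_tuple (I : finType) d (T : measurableType d) (V : I -> T -> R) :
  (forall i, measurable_fun setT (V i)) -> measurable_fun setT (family_tuple V).
Proof.
move=> mV; apply/measurable_fun_tnthP => i.
rewrite (_ : _ \o _ = V (enum_val i)); first exact: mV.
by apply/funext => w /=; rewrite tnth_mktuple.
Qed.

Lemma lower_box_family (I : finType) T (V : I -> T -> R) (c : I -> R) :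
  family_tuple V @^-1` lower_box (c \o enum_val) = [set w | forall i, V i w < c i].
Proof.
apply/seteqP; split => w /= H i.
  by have := H (enum_rank i); rewrite tnth_family_tuple/= enum_rankK.
by rewrite tnth_mktuple; exact: H.
Qed.

Lemma eq_family_law_tuple (I : finType) (V1 : I -> Omega1 -> R) (V2 : I -> Omega2 -> R) :
  (forall i, measurable_fun setT (V1 i)) -> (forall i, measurable_fun setT (V2 i)) ->
  (forall c : I -> R,
     P1 [set w | forall i, V1 i w < c i] = P2 [set w | forall i, V2 i w < c i]) ->
  forall S, measurable S ->
    P1 (family_tuple V1 @^-1` S) = P2 (family_tuple V2 @^-1` S).
Proof.
move=> mV1 mV2 H S mS.
have mt1 := measurable_family_tuple mV1; have mt2 := measurable_family_tuple mV2.
have meas1 c : pushforward P1 (family_tuple V1) (lower_box (c \o enum_val)) =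
    pushforward P2 (family_tuple V2) (lower_box (c \o enum_val)).
  by rewrite /pushforward !lower_box_family; exact: H.
have unique := @tuple_measure_unique _ _ (pushforward P1 (family_tuple V1))
  (pushforward P2 (family_tuple V2)).
apply: (unique mt1 mt2) => //.
  by rewrite /= /pushforward preimage_setT probability_setT ltry.
move=> c; have -> : c = (c \o enum_rank) \o enum_val.
  by apply/funext => i /=; rewrite enum_valK.
exact: meas1.
Qed.

Lemma eq_family_law_lower (I : finType) (V1 : I -> Omega1 -> R) (V2 : I -> Omega2 -> R) :
  (forall i, measurable_fun setT (V1 i)) -> (forall i, measurable_fun setT (V2 i)) ->
  (forall c : I -> R,
     P1 [set w | forall i, V1 i w < c i] = P2 [set w | forall i, V2 i w < c i]) ->
  eq_family_law V1 V2.
Proof.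
move=> mV1 mV2 H E mE.
pose S := [set x : #|I|.-tuple R | forall i, E i (tnth x (enum_rank i))].
have mS : measurable S.
  rewrite (_ : S = \bigcap_(i in setT) ((fun x => tnth x (enum_rank i)) @^-1` E i)).
    apply: fin_bigcap_measurable => // i _; rewrite -[X in measurable X]setTI.
    by apply: measurable_tnth => //; exact: mE.
  by apply/seteqP; split => x /= Sx i; [move=> _; exact: Sx|exact: Sx].
have := eq_family_law_tuple mV1 mV2 H mS.
have SE T (V : I -> T -> R) :
    family_tuple V @^-1` S = [set w | forall i, E i (V i w)].
  by apply/seteqP; split => w /= Sw i; have := Sw i; rewrite tnth_family_tuple.
by rewrite !SE.
Qed.

(** Agreement on product events forces agreement of the joint laws, hence of the laws of any
    measurable functions of the families. *)
Lemma eq_family_law_comp (I J : finType) (V1 : I -> Omega1 -> R) (V2 : I -> Omega2 -> R)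
    (Psi : J -> (I -> R) -> R) :
  (forall i, measurable_fun setT (V1 i)) -> (forall i, measurable_fun setT (V2 i)) ->
  (forall j, measurable_fun setT
     (fun x : #|I|.-tuple R => Psi j (fun i => tnth x (enum_rank i)))) ->
  eq_family_law V1 V2 ->
  eq_family_law (fun j w => Psi j (V1^~ w)) (fun j w => Psi j (V2^~ w)).
Proof.
move=> mV1 mV2 mPsi H E mE.
pose S := [set x : #|I|.-tuple R | forall j, E j (Psi j (fun i => tnth x (enum_rank i)))].
have mS : measurable S.
  rewrite (_ : S = \bigcap_(j in setT)
      ((fun x : #|I|.-tuple R => Psi j (fun i => tnth x (enum_rank i))) @^-1` E j)).
    apply: fin_bigcap_measurable => // j _; rewrite -[X in measurable X]setTI.
    by apply: mPsi => //; exact: mE.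
  by apply/seteqP; split => x /= Sx i; [move=> _; exact: Sx|exact: Sx].
have Hc (c : I -> R) : P1 [set w | forall i, V1 i w < c i] = P2 [set w | forall i, V2 i w < c i].
  have := H (fun i => `]-oo, c i[%classic) (fun i => measurable_itv _).
  congr (P1 _ = P2 _); by apply/seteqP; split => w /= Hw i; have := Hw i; rewrite in_itv.
have := eq_family_law_tuple mV1 mV2 Hc mS.
have SE T (V : I -> T -> R) :
    family_tuple V @^-1` S = [set w | forall j, E j (Psi j (V^~ w))].
  have VE w : (fun i => tnth (family_tuple V w) (enum_rank i)) = V^~ w.
    by apply/funext => i; rewrite tnth_family_tuple.
  by apply/seteqP; split => w /= Sw j; have := Sw j; rewrite VE.
by rewrite !SE.
Qed.

End family_law.

Lemma probability_exists_le (R : realType) (I : finType) d (T : measurableType d)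
    (P : probability T R) (D : I -> set T) (e : R) :
  (forall i, measurable (D i)) -> (forall i, (P (D i) <= e%:E)%E) ->
  measurable [set w | exists i, D i w] /\
  (P [set w | exists i, D i w] <= (#|I|%:R * e)%:E)%E.
Proof.
move=> mD H.
have -> : [set w | exists i, D i w] = \big[setU/set0]_(i <- enum I) D i.
  rewrite -bigcup_seq; apply/seteqP; split => w /=.
    by move=> [i Di]; exists i => //=; rewrite mem_enum.
  by move=> [i _ Di]; exists i.
split; first exact: bigsetU_measurable.
have -> : (#|I|%:R * e = \sum_(i <- enum I) e)%R.
  by rewrite big_enum/= sumr_const mulr_natl.
elim: (enum I) => [|i r IHr]; first by rewrite !big_nil measure0.
rewrite !big_cons EFinD; apply: le_trans (measureU2 _ _ _) _ => //.
  exact: bigsetU_measurable.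
exact: leeD (H i) IHr.
Qed.

(** * Equality in law through limits in probability *)

Section limit_law.
Context {R : realType}.

Lemma measurable_lower (I : finType) d (T : measurableType d) (V : I -> T -> R) (c : I -> R) :
  (forall i, measurable_fun setT (V i)) -> measurable [set w | forall i, V i w < c i].
Proof.
move=> mV; rewrite -lower_box_family -[X in measurable X]setTI.
apply: (measurable_family_tuple mV) => //.
by rewrite measurable_tuple_lower_box; apply: sub_sigma_algebra; exists (c \o enum_val).
Qed.

Lemma measurable_dist d (T : measurableType d) (f g : T -> R) (e : R) :
  measurable_fun setT f -> measurable_fun setT g ->
  measurable [set w | (e <= `|f w - g w|)%R].
Proof.
move=> mf mg; have mfg : measurable_fun setT (fun w => `|f w - g w|).
  by apply: measurableT_comp => //; exact: measurable_funB.
have := mfg measurableT `[e, +oo[%classic (measurable_itv _).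
by rewrite setTI; congr measurable; apply/seteqP; split => w /=; rewrite in_itv/= andbT.
Qed.

Definition close_in_probability (I : finType) d (T : measurableType d)
    (P : probability T R) (e : R) (V V' : I -> T -> R) :=
  forall i, (P [set w | (e <= `|V i w - V' i w|)%R] <= e%:E)%E.

Lemma close_in_probability_sym (I : finType) d (T : measurableType d)
    (P : probability T R) (e : R) (V V' : I -> T -> R) :
  close_in_probability P e V V' -> close_in_probability P e V' V.
Proof.
move=> H i; rewrite (_ : [set w | _] = [set w | (e <= `|V i w - V' i w|)%R])//.
by apply/seteqP; split => w /=; rewrite distrC.
Qed.

(** If every [V i] is below [c i - e] while some [V' i] is not below [c i], then that coordinate
    moved by at least [e]; the union bound does the rest. *)
Lemma probability_lower_perturb (I : finType) d (T : measurableType d) (P : probability T R)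
    (V V' : I -> T -> R) (c : I -> R) (e : R) :
  (forall i, measurable_fun setT (V i)) -> (forall i, measurable_fun setT (V' i)) ->
  close_in_probability P e V V' ->
  (P [set w | forall i, (V i w < c i - e)%R] <=
   P [set w | forall i, (V' i w < c i)%R] + (#|I|%:R * e)%:E)%E.
Proof.
move=> mV mV' H.
have mD i : measurable [set w | (e <= `|V i w - V' i w|)%R] by exact: measurable_dist.
have [mU PU] := probability_exists_le mD H.
have mL := measurable_lower c mV'.
apply: (@le_trans _ _ (P ([set w | forall i, (V' i w < c i)%R] `|`
    [set w | exists i, (e <= `|V i w - V' i w|)%R]))).
  apply: le_measure; rewrite ?inE.
  - exact: measurable_lower.
  - exact: measurableU.
  - move=> w /= Vw; have [|/forallNP H'] := pselect (exists i, e <= `|V i w - V' i w|).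
      by right.
    left => i; have := Vw i; have /negP := H' i.
    by rewrite -ltNge ltr_norml => /andP[+ _]; lra.
by apply: le_trans (measureU2 _ _ _) _ => //; rewrite leeD2l.
Qed.

Definition approximable_law (I : finType) d1 (Omega1 : measurableType d1)
    (P1 : probability Omega1 R) d2 (Omega2 : measurableType d2) (P2 : probability Omega2 R)
    (V1 : I -> Omega1 -> R) (V2 : I -> Omega2 -> R) :=
  forall e : R, 0 < e -> exists (V1' : I -> Omega1 -> R) (V2' : I -> Omega2 -> R),
    (forall i, measurable_fun setT (V1' i) /\ measurable_fun setT (V2' i)) /\
    [/\ eq_family_law P1 P2 V1' V2', close_in_probability P1 e V1' V1 &
        close_in_probability P2 e V2' V2].

(** Passing from [V1] to its approximation, and from the other approximation to [V2], costs [e] in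
    the bounds and [#|I| * e] in probability each time. Then [e] tends to 0, with continuity from
    below on the left. The hypothesis is symmetric, so one inequality suffices. *)
Lemma approximable_law_le (I : finType) d1 (Omega1 : measurableType d1)
    (P1 : probability Omega1 R) d2 (Omega2 : measurableType d2) (P2 : probability Omega2 R)
    (V1 : I -> Omega1 -> R) (V2 : I -> Omega2 -> R) (c : I -> R) :
  (forall i, measurable_fun setT (V1 i)) -> (forall i, measurable_fun setT (V2 i)) ->
  approximable_law P1 P2 V1 V2 ->
  (P1 [set w | forall i, (V1 i w < c i)%R] <= P2 [set w | forall i, (V2 i w < c i)%R])%E.
Proof.
move=> mV1 mV2 H.
have HP (e : R) : 0 < e -> (P1 [set w | forall i, (V1 i w < c i - 2 * e)%R] <=
    P2 [set w | forall i, (V2 i w < c i)%R] + (2 * #|I|%:R * e)%:E)%E.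
  move=> e0; have [V1' [V2' [mV [L H1 H2]]]] := H e e0.
  have mV1' i : measurable_fun setT (V1' i) by case: (mV i).
  have mV2' i : measurable_fun setT (V2' i) by case: (mV i).
  have -> : [set w | forall i, V1 i w < c i - 2 * e] =
      [set w | forall i, V1 i w < (c i - e) - e].
    by apply/seteqP; split => w /= Hw i; apply: lt_le_trans (Hw i) _; lra.
  apply: le_trans (probability_lower_perturb (fun i => c i - e) mV1 mV1'
    (close_in_probability_sym H1)) _.
  have E2 := L (fun i => `]-oo, (c i - e)%R[%classic) (fun i => measurable_itv _).
  have itvE T (V : I -> T -> R) : [set w | forall i, `]-oo, (c i - e)%R[%classic (V i w)] =
      [set w | forall i, V i w < c i - e].
    by apply/seteqP; split => w /= Hw i; have := Hw i; rewrite in_itv.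
  rewrite !itvE in E2; rewrite E2.
  apply: (@le_trans _ _ (P2 [set w | forall i, (V2 i w < c i)%R]
      + (#|I|%:R * e)%:E + (#|I|%:R * e)%:E)%E).
    by rewrite leeD2r//; exact: probability_lower_perturb.
  by rewrite -addeA leeD2l// -EFinD lee_fin; lra.
pose D n := [set w | forall i, (V1 i w < c i - 2 * n.+1%:R^-1)%R].
have mono m n : (m <= n)%N -> D m `<=` D n.
  move=> mn w Dw i; apply: lt_le_trans (Dw i) _.
  by rewrite lerD2l lerN2 ler_wpM2l// lef_pV2 ?posrE// ler_nat ltnS.
have PD n : (P1 (D n) <= P2 [set w | forall i, (V2 i w < c i)%R])%E.
  apply/lee_addgt0Pr => e e0.
  (* Large enough that [D n] lies in [D m] and the error [2 #|I| / (m + 1)] is at most [e]. *)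
  pose m := maxn n (Num.trunc (2 * #|I|%:R / e)).
  apply: (@le_trans _ _ (P1 (D m))).
    apply: le_measure; rewrite ?inE; [exact: measurable_lower|exact: measurable_lower|].
    exact/mono/leq_maxl.
  apply: le_trans (HP m.+1%:R^-1 _) _; first by rewrite invr_gt0.
  rewrite leeD2l// lee_fin ler_pdivrMr// [leRHS]mulrC -ler_pdivrMr//.
  apply: le_trans (ltW (truncnS_gt _)) _.
  by rewrite ler_nat ltnS leq_maxr.
have DU : [set w | forall i, (V1 i w < c i)%R] = \bigcup_n D n.
  apply/seteqP; split => w /=; last first.
    move=> [n _ Dw] i; apply: lt_le_trans (Dw i) _.
    by rewrite gerBl// mulr_ge0// invr_ge0.
  move=> Vw; pose S := \sum_i (c i - V1 i w)^-1.
  (* [S] dominates the inverse of every gap [c i - V1 i w], so [2 / (n + 1)] is below all the gaps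
     at once. *)
  exists (Num.trunc (2 * S)) => // i.
  have ci : 0 < c i - V1 i w by rewrite subr_gt0.
  have Sge : (c i - V1 i w)^-1 <= S.
    rewrite /S (bigD1 i)//= lerDl sumr_ge0// => j _.
    by rewrite invr_ge0 subr_ge0 ltW.
  rewrite ltrBrDr addrC -ltrBrDr ltr_pdivrMr// mulrC -ltr_pdivrMr//.
  apply: le_lt_trans (truncnS_gt _).
  by rewrite ler_wpM2l.
rewrite DU.
have cvgD : (P1 (D n) @[n --> \oo] --> P1 (\bigcup_n D n)).
  apply: nondecreasing_cvg_mu.
  - by move=> n; exact: measurable_lower.
  - by rewrite -DU; exact: measurable_lower.
  - by move=> m n mn; apply/subsetPset; exact: mono.
rewrite -(cvg_lim _ cvgD)//; apply: lime_le; first by apply/cvg_ex; eexists; exact: cvgD.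
by apply: nearW.
Qed.

Lemma eq_family_law_limit (I : finType) d1 (Omega1 : measurableType d1)
    (P1 : probability Omega1 R) d2 (Omega2 : measurableType d2) (P2 : probability Omega2 R)
    (V1 : I -> Omega1 -> R) (V2 : I -> Omega2 -> R) :
  (forall i, measurable_fun setT (V1 i)) -> (forall i, measurable_fun setT (V2 i)) ->
  approximable_law P1 P2 V1 V2 -> eq_family_law P1 P2 V1 V2.
Proof.
move=> mV1 mV2 H; apply: eq_family_law_lower => // c.
apply/eqP; rewrite eq_le !approximable_law_le// => e e0.
have [V1' [V2' [mV [L H1 H2]]]] := H e e0; exists V2', V1'.
by split=> [i|]; [case: (mV i)|split=> // E mE; rewrite L].
Qed.

End limit_law.

(** * The law of a discretized Brownian motion *)

Section adapted.
Context {R : realType} d (Omega : measurableType d).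
Implicit Types (G : set (set Omega)) (f g : Omega -> R).

Definition measurable_for G f := forall E : set R, measurable E -> G [set w | E (f w)].

(** Equipping [Omega] with [G] as its measurable structure transfers the closure properties of
    measurable functions to a sub-sigma-algebra. *)
Lemma measurable_forP G f : sigma_algebra setT G ->
  measurable_for G f <-> measurable_fun setT (f : g_sigma_algebraType G -> R).
Proof.
move=> sG; have GE : <<s G>> = G by exact: sigma_algebra_id.
split=> [Gf _ E mE|mf E mE].
  by rewrite setTI /measurable/= GE; exact: Gf.
by have := mf measurableT E mE; rewrite setTI /measurable/= GE.
Qed.

Lemma measurable_for_fun G f : G `<=` measurable -> measurable_for G f ->
  measurable_fun setT f.
Proof. by move=> GM Gf _ E mE; rewrite setTI; apply/GM/Gf. Qed.

Lemma measurable_for_sub G G' f : G `<=` G' -> measurable_for G f -> measurable_for G' f.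
Proof. by move=> GG' Gf E mE; apply/GG'/Gf. Qed.

Lemma measurable_for_cst G (c : R) : sigma_algebra setT G -> measurable_for G (fun=> c).
Proof. by move=> sG; apply/measurable_forP => //; exact: measurable_cst. Qed.

Lemma measurable_forD G f g : sigma_algebra setT G ->
  measurable_for G f -> measurable_for G g -> measurable_for G (fun w => f w + g w).
Proof.
move=> sG /measurable_forP Gf /measurable_forP Gg; apply/measurable_forP => //.
by apply: measurable_funD; [exact: Gf|exact: Gg].
Qed.

Lemma measurable_forM G f g : sigma_algebra setT G ->
  measurable_for G f -> measurable_for G g -> measurable_for G (fun w => f w * g w).
Proof.
move=> sG /measurable_forP Gf /measurable_forP Gg; apply/measurable_forP => //.
by apply: measurable_funM; [exact: Gf|exact: Gg].
Qed.

Lemma measurable_forN G f : sigma_algebra setT G ->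
  measurable_for G f -> measurable_for G (fun w => - f w).
Proof.
move=> sG /measurable_forP Gf; apply/measurable_forP => //.
by apply: measurable_funN; exact: Gf.
Qed.

Lemma measurable_for_sum G n (f : 'I_n -> Omega -> R) : sigma_algebra setT G ->
  (forall i, measurable_for G (f i)) -> measurable_for G (fun w => \sum_i f i w).
Proof.
move=> sG Gf.
rewrite (_ : (fun w => _) = fun w => \sum_(i <- enum 'I_n) f i w); last first.
  by apply/funext => w; rewrite big_enum.
elim: (enum 'I_n) => [|i r IH].
  by under eq_fun do rewrite big_nil; exact: measurable_for_cst.
by under eq_fun do rewrite big_cons; exact: measurable_forD.
Qed.

Lemma sigma_algebra_forall G (I : finType) (A : I -> set Omega) : sigma_algebra setT G ->
  (forall i, G (A i)) -> G [set w | forall i, A i w].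
Proof.
move=> sG GA; have GE : <<s G>> = G by exact: sigma_algebra_id.
have H : @measurable _ (g_sigma_algebraType G) (\bigcap_(i in setT) A i).
  by apply: fin_bigcap_measurable => // i _; rewrite /measurable/= GE.
rewrite (_ : [set w | _] = \bigcap_(i in setT) A i).
  by move: H; rewrite /measurable/= GE.
by apply/seteqP; split => w /= Aw i; [move=> _; exact: Aw|exact: Aw].
Qed.

End adapted.

Section brownian_increments.
Context {R : realType} {k : nat} d (Omega : measurableType d) (P : probability Omega R).
Variables (F : R -> set (set Omega)) (W : R -> Omega -> 'cV[R]_k).
Hypotheses (filF : is_filtration F) (brW : is_brownian P F W).

Lemma filtration_sigma t : 0 <= t -> sigma_algebra setT (F t).
Proof. by case: filF => H _ /H[]. Qed.

Lemma filtration_measurable t : 0 <= t -> F t `<=` measurable.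
Proof. by case: filF => H _ /H[]. Qed.

Lemma filtration_mono s t : 0 <= s -> s <= t -> F s `<=` F t.
Proof. by case: filF => _; exact. Qed.

Lemma brownian_adapted s t a : 0 <= s -> s <= t -> measurable_for (F t) (fun w => W s w a 0).
Proof.
move=> s0 st; apply: (measurable_for_sub (filtration_mono s0 st)) => E mE.
by case: brW => /(_ s s0 a 0 E mE).
Qed.

Lemma brownian_measurable t a : 0 <= t -> measurable_fun setT (fun w => W t w a 0).
Proof.
move=> t0; apply: (measurable_for_fun (filtration_measurable t0)).
exact: brownian_adapted.
Qed.

Variable s : nat -> R.
Hypotheses (s0 : s 0%N = 0) (s_incr : forall i, s i < s i.+1).

Lemma grid_mono i j : (i <= j)%N -> s i <= s j.
Proof.
by apply: (@homo_leq _ s (fun x y => x <= y)) => // [y x z|m]; [exact: le_trans|exact: ltW].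
Qed.

Lemma grid_ge0 i : 0 <= s i.
Proof. by rewrite -s0; exact: grid_mono. Qed.

Lemma brownian_increments_adapted n (E : nat -> 'I_k -> set R) :
  (forall i a, measurable (E i a)) ->
  F (s n) [set w | forall i, (i < n)%N -> forall a, E i a (W (s i.+1) w a 0 - W (s i) w a 0)].
Proof.
move=> mE; have sF := filtration_sigma (grid_ge0 n).
pose A (i : 'I_n) := [set w | forall a, E i a (W (s i.+1) w a 0 - W (s i) w a 0)].
rewrite (_ : [set w | _] = [set w | forall i : 'I_n, A i w]); last first.
  apply/seteqP; split => w /= H i; first by move=> a; exact: H.
  by move=> ni; exact: (H (Ordinal ni)).
apply: sigma_algebra_forall => // i.
apply: (sigma_algebra_forall
  (A := fun a => [set w | E i a (W (s i.+1) w a 0 - W (s i) w a 0)])) => // a.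
have H : measurable_for (F (s n)) (fun w => W (s i.+1) w a 0 + - W (s i) w a 0).
  apply: measurable_forD => //; last apply: measurable_forN => //.
    by apply: brownian_adapted; [exact: grid_ge0|exact: grid_mono].
  by apply: brownian_adapted; [exact: grid_ge0|apply/grid_mono/ltnW].
exact: H.
Qed.

(** Induction on [n]: the event about the first [n] increments belongs to [F (s n)] and serves as
    the set [A] of the product formula for the next one. *)
Lemma brownian_increments_law n (E : nat -> 'I_k -> set R) :
  (forall i a, measurable (E i a)) ->
  P [set w | forall i, (i < n)%N -> forall a, E i a (W (s i.+1) w a 0 - W (s i) w a 0)] =
  \big[*%E/1%E]_(i < n) \big[*%E/1%E]_(a < k) normal_prob 0 (Num.sqrt (s i.+1 - s i)) (E i a).
Proof.
move=> mE; elim: n => [|n IHn].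
  rewrite big_ord0 (_ : [set w | _] = setT) ?probability_setT//.
  by apply/seteqP; split.
rewrite big_ord_recr/= -IHn.
case: brW => _ [_ [_ /(_ (s n) (s n.+1) (grid_ge0 n) (s_incr n) _ (E n)
  (brownian_increments_adapted n mE) (mE n)) <-]].
congr (P _); apply/seteqP; split => w /=.
  move=> H; split => [i ni|]; last exact: H.
  by apply: H; rewrite ltnS ltnW.
move=> [H Hn] i; rewrite ltnS leq_eqVlt => /orP[/eqP -> //|]; exact: H.
Qed.

End brownian_increments.

Section grid.
Context {R : realType} (tau : nat -> R).
Hypotheses (tau0 : tau 0%N = 0) (tau_incr : forall l, tau l < tau l.+1).

(** Each interval between consecutive times of [tau] is cut into [q] equal parts, so that [tau l]
    has index [l * q] and a single grid partitions all the [[0, tau l]]. *)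
Definition refined_grid (q i : nat) : R :=
  tau (i %/ q) + (i %% q)%:R * ((tau (i %/ q).+1 - tau (i %/ q)) / q%:R).

Lemma refined_gridM q l : (0 < q)%N -> refined_grid q (l * q) = tau l.
Proof. by move=> q0; rewrite /refined_grid mulnK// modnMl mul0r addr0. Qed.

Lemma refined_grid_step q i : (0 < q)%N ->
  refined_grid q i.+1 - refined_grid q i = (tau (i %/ q).+1 - tau (i %/ q)) / q%:R.
Proof.
move=> q0; have q0' : q%:R != 0 :> R by rewrite pnatr_eq0 -lt0n.
set l := (i %/ q)%N; set r := (i %% q)%N.
have -> : i.+1 = (l * q + r.+1)%N by rewrite addnS -divn_eq.
have rq : (r < q)%N by rewrite ltn_mod.
have [r1|r1] := ltnP r.+1 q.
  rewrite /refined_grid divnMDl// modnMDl divn_small// modn_small// addn0 -/l -/r.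
  by rewrite -natr1; ring.
have -> : (l * q + r.+1 = l.+1 * q)%N by rewrite mulSnr; congr addn; apply/eqP; rewrite eqn_leq rq.
rewrite refined_gridM// /refined_grid -/l -/r.
have -> : q%:R = r%:R + 1 :> R.
  by rewrite natr1; congr (_%:R); apply/eqP; rewrite eqn_leq r1.
by field; rewrite natr1 pnatr_eq0.
Qed.

Lemma refined_grid_incr q i : (0 < q)%N -> refined_grid q i < refined_grid q i.+1.
Proof.
move=> q0; rewrite -subr_gt0 refined_grid_step// divr_gt0 ?ltr0n//.
by rewrite subr_gt0.
Qed.

Lemma refined_grid_mesh n (delta : R) : 0 < delta ->
  exists2 q, (0 < q)%N & forall i, (i < n * q)%N ->
    refined_grid q i.+1 - refined_grid q i < delta.
Proof.
(* Below [tau n] every interval of [tau] has length at most [tau n], so [q > tau n / delta] is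
   enough. *)
move=> d0; exists (Num.trunc (tau n / delta)).+1 => // i iq.
rewrite refined_grid_step// ltr_pdivrMr// [ltRHS]mulrC -ltr_pdivrMr//.
apply: le_lt_trans (truncnS_gt _); rewrite ler_pM2r ?invr_gt0//.
have tau_mono := grid_mono tau_incr.
rewrite lerBlDr (@le_trans _ _ (tau n))//; first by apply: tau_mono; rewrite ltn_divLR.
by rewrite lerDl -tau0; exact: tau_mono.
Qed.

Lemma is_partition_refined_grid n q delta l : (0 < q)%N -> (l <= n)%N ->
  (forall i, (i < n * q)%N -> refined_grid q i.+1 - refined_grid q i < delta) ->
  is_partition (tau l) delta (l * q) (refined_grid q).
Proof.
move=> q0 ln H; split => [||i il].
- by have := refined_gridM 0 q0; rewrite mul0n tau0.
- exact: refined_gridM.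
rewrite H ?andbT; last by apply: leq_trans il _; rewrite leq_mul2r ln orbT.
by rewrite subr_ge0 ltW// refined_grid_incr.
Qed.

End grid.

Section almost_sure.
Context {R : realType} d (T : measurableType d) (P : probability T R).
Local Open Scope ereal_scope.

Lemma le_measure_ae (A B : set T) : measurable A -> measurable B ->
  {ae P, forall w, A w -> B w} -> P A <= P B.
Proof.
move=> mA mB [N [mN N0 AB]].
apply: (@le_trans _ _ (P (B `|` N))).
  apply: le_measure; rewrite ?inE//; first exact: measurableU.
  move=> w Aw; have [Bw|Bw] := pselect (B w); [by left|right].
  by apply: AB => /(_ Aw).
apply: le_trans (measureU2 _ mB mN) _.
by rewrite [X in _ + X](_ : _ = 0) ?adde0.
Qed.

End almost_sure.

Lemma common_threshold (R : realType) (J : finType) (Q : J -> R -> Prop) :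
  (forall j e e', e' <= e -> Q j e -> Q j e') ->
  (forall j, exists2 e, 0 < e & Q j e) -> exists2 e, 0 < e & forall j, Q j e.
Proof.
move=> mQ H.
have H' j : exists e, 0 < e /\ Q j e by have [e e0 Qe] := H j; exists e.
have [f fP] := choice H'.
have S0 : 0 <= \sum_j (f j)^-1 by rewrite sumr_ge0// => j _; rewrite invr_ge0 ltW; case: (fP j).
(* A positive lower bound of all the [f j], valid also for empty [J]. *)
exists (1 + \sum_j (f j)^-1)^-1; first by rewrite invr_gt0 ltr_pwDl.
move=> j; have [fj Qj] := fP j; apply: mQ Qj.
rewrite -[leRHS]invrK lef_pV2 ?posrE ?invr_gt0 ?ltr_pwDl//.
rewrite (bigD1 j)//= addrCA lerDl addr_ge0// sumr_ge0// => i _.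
by rewrite invr_ge0 ltW; case: (fP i).
Qed.

Section driving_noise_law.
Context {R : realType} {k : nat} (tau : nat -> R).
Hypotheses (tau0 : tau 0%N = 0) (tau_incr : forall l, tau l < tau l.+1).

Definition coord_index : Type := option ('I_k + 'I_k * 'I_k).
HB.instance Definition _ := Finite.on coord_index.

Definition noise_coord (z : noise R k) (j : coord_index) : R :=
  match j with
  | None => z.1.1
  | Some (inl a) => z.1.2 a 0
  | Some (inr (a, b)) => z.2 a b
  end.

(* The noise at time [tau l] with the Ito integrals replaced by Riemann sums,
   as a function of the increments [x] of the Brownian motion on the grid. *)
Definition riemann_noise (n q : nat) (lj : 'I_n.+1 * coord_index)
  (x : 'I_(n * q) * 'I_k -> R) : R :=
  let sum a m := \sum_(i < n * q) if (i < m)%N then x (i, a) else 0 in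
  match lj.2 with
  | None => tau lj.1
  | Some (inl a) => sum a (lj.1 * q)%N
  | Some (inr (a, b)) =>
      \sum_(i < n * q) if (i < lj.1 * q)%N then sum a i * x (i, b) else 0
  end.

Lemma measurable_riemann_noise n q lj d (T : measurableType d)
    (x : 'I_(n * q) * 'I_k -> T -> R) :
  (forall ia, measurable_fun setT (x ia)) ->
  measurable_fun setT (fun w => riemann_noise (n := n) lj (x^~ w)).
Proof.
move=> mx.
have msum a m : measurable_fun setT (fun w => \sum_(i < n * q) if (i < m)%N then x (i, a) w else 0).
  by apply: measurable_sum => i; case: (i < m)%N; [exact: mx|exact: measurable_cst].
rewrite /riemann_noise; case: lj => l [[a|[a b]]|] /=.
- exact: msum.
- apply: measurable_sum => i; case: (i < l * q)%N; last exact: measurable_cst.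
  by apply: measurable_funM; [exact: msum|exact: mx].
- exact: measurable_cst.
Qed.

Section one_noise.
Context d (Omega : measurableType d) (P : probability Omega R).
Variables (F : R -> set (set Omega)) (W : R -> Omega -> 'cV[R]_k)
  (Z : nat -> Omega -> noise R k).
Hypotheses (filF : is_filtration F) (brW : is_brownian P F W)
  (adZ : noise_adapted F tau Z) (discZ : is_discretization P tau W Z).

Let tau_ge0 l : 0 <= tau l. Proof. exact: grid_ge0. Qed.

Lemma measurable_noise_coord l j : measurable_fun setT (fun w => noise_coord (Z l w) j).
Proof.
have [H0 H1 H2] := adZ l; have FM := filtration_measurable filF (tau_ge0 l).
case: j => [[a|[a b]]|] /=.
- by apply: (measurable_for_fun FM) => E mE; exact: H1.
- by apply: (measurable_for_fun FM) => E mE; exact: H2.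
- exact: (measurable_for_fun FM).
Qed.

Definition grid_increments (n q : nat) (ia : 'I_(n * q) * 'I_k) (w : Omega) : R :=
  W (refined_grid tau q ia.1.+1) w ia.2 0 - W (refined_grid tau q ia.1) w ia.2 0.

Section with_q.
Variables (n q : nat) (q0 : (0 < q)%N).

Let s := refined_grid tau q.
Let s0 : s 0%N = 0. Proof. by have := refined_gridM tau 0 q0; rewrite mul0n tau0. Qed.
Let s_incr i : s i < s i.+1. Proof. exact: refined_grid_incr. Qed.
Let s_ge0 i : 0 <= s i. Proof. exact: grid_ge0. Qed.

Lemma measurable_grid_increments ia :
  measurable_fun setT (grid_increments (n := n) (q := q) ia).
Proof. by apply: measurable_funB; exact: (brownian_measurable filF brW). Qed.

Lemma sum_grid_increments w a m : (m <= n * q)%N -> W 0 w = 0 ->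
  \sum_(i < n * q) (if (i < m)%N then grid_increments (n := n) (q := q) (i, a) w else 0) =
  W (s m) w a 0.
Proof.
move=> mnq W0; rewrite -big_mkcond/=.
rewrite -(big_ord_widen_cond (n * q) xpredT (fun i => W (s i.+1) w a 0 - W (s i) w a 0))//.
rewrite -(big_mkord xpredT (fun i => W (s i.+1) w a 0 - W (s i) w a 0)).
by rewrite telescope_sumr// s0 W0 mxE subr0.
Qed.

(** The time and Brownian coordinates are reproduced exactly, almost surely, by telescoping from
    [W 0 = 0]; only the iterated integrals carry an error. *)
Lemma riemann_noise_near (e : R) (l : 'I_n.+1) j : 0 < e ->
  (forall a b, (P [set w | (e <= `| \sum_(i < l * q) W (s i) w a 0 *
      (W (s i.+1) w b 0 - W (s i) w b 0) - (Z l w).2 a b|)%R] <= e%:E)%E) ->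
  (P [set w | (e <= `| riemann_noise (l, j) ((grid_increments (n := n) (q := q))^~ w)
     - noise_coord (Z l w) j|)%R] <= e%:E)%E.
Proof.
move=> e0 He.
have [Z0 [Z1 _]] := discZ l; have [_ [W0 _]] := brW.
have lq : (l * q <= n * q)%N by rewrite leq_mul2r -ltnS ltn_ord orbT.
have mset : measurable [set w | (e <= `| riemann_noise (l, j)
    ((grid_increments (n := n) (q := q))^~ w) - noise_coord (Z l w) j|)%R].
  apply: measurable_dist; last exact: measurable_noise_coord.
  by apply: measurable_riemann_noise => ia; exact: measurable_grid_increments.
case: j mset => [[a|[a b]]|] mset.
- apply: (@le_trans _ _ (P set0)); last by rewrite measure0 lee_fin ltW.
  apply: le_measure_ae => //; apply: filterS2 W0 Z1 => w W0 Z1 /=.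
  rewrite /riemann_noise/= sum_grid_increments// /s refined_gridM// Z1 subrr normr0.
  by rewrite leNgt e0.
- apply: le_trans (He a b); apply: le_measure_ae => //.
    apply: measurable_dist.
      apply: measurable_sum => i; apply: measurable_funM.
        exact: (brownian_measurable filF brW).
      by apply: measurable_funB; exact: (brownian_measurable filF brW).
    exact: (measurable_noise_coord l (Some (inr (a, b)))).
  apply: filterS W0 => w W0 /=.
  suff -> : riemann_noise (l, Some (inr (a, b))) ((grid_increments (n := n) (q := q))^~ w) =
    \sum_(i < l * q) W (s i) w a 0 * (W (s i.+1) w b 0 - W (s i) w b 0) by [].
  rewrite /riemann_noise/= -big_mkcond/=.
  rewrite (big_ord_widen_cond (n * q) xpredT
    (fun i => W (s i) w a 0 * (W (s i.+1) w b 0 - W (s i) w b 0)))//=.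
  apply: eq_bigr => i il; rewrite sum_grid_increments//.
  by apply: leq_trans (ltnW il) lq.
- apply: (@le_trans _ _ (P set0)); last by rewrite measure0 lee_fin ltW.
  apply: le_measure_ae => //; apply: filterS Z0 => w Z0 /=.
  by rewrite /riemann_noise/= Z0 subrr normr0 leNgt e0.
Qed.

End with_q.

(** One mesh for the finitely many times up to [n] and all pairs of components. *)
Lemma fine_mesh n (e : R) : 0 < e -> exists2 delta : R, 0 < delta &
  forall (l : 'I_n.+1) (a b : 'I_k) n' s, is_partition (tau l) delta n' s ->
    (P [set w | (e <= `| \sum_(i < n') W (s i) w a 0 *
      (W (s i.+1) w b 0 - W (s i) w b 0) - (Z l w).2 a b|)%R] <= e%:E)%E.
Proof.
move=> e0.
have [|j|delta d0 H] := @common_threshold R ('I_n.+1 * ('I_k * 'I_k))%type (fun lab delta =>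
  forall n' s, is_partition (tau lab.1) delta n' s ->
    (P [set w | (e <= `| \sum_(i < n') W (s i) w lab.2.1 0 *
      (W (s i.+1) w lab.2.2 0 - W (s i) w lab.2.2 0)
      - (Z lab.1 w).2 lab.2.1 lab.2.2|)%R] <= e%:E)%E).
- move=> j r r' r'r H n' s [s0 sn sr]; apply: H; split => // i /sr /andP[-> /=] h.
  exact: lt_le_trans r'r.
- by have [_ [_ I]] := discZ j.1; exact: I.
by exists delta => // l a b; exact: (H (l, (a, b))).
Qed.

End one_noise.

Lemma driving_noise_law d1 (Omega1 : measurableType d1) (P1 : probability Omega1 R)
    (F1 : R -> set (set Omega1)) (W1 : R -> Omega1 -> 'cV[R]_k)
    (Z1 : nat -> Omega1 -> noise R k) d2 (Omega2 : measurableType d2)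
    (P2 : probability Omega2 R) (F2 : R -> set (set Omega2)) (W2 : R -> Omega2 -> 'cV[R]_k)
    (Z2 : nat -> Omega2 -> noise R k) :
  is_filtration F1 -> is_brownian P1 F1 W1 -> noise_adapted F1 tau Z1 ->
  is_discretization P1 tau W1 Z1 ->
  is_filtration F2 -> is_brownian P2 F2 W2 -> noise_adapted F2 tau Z2 ->
  is_discretization P2 tau W2 Z2 ->
  same_law P1 Z1 P2 Z2.
Proof.
move=> fil1 br1 ad1 disc1 fil2 br2 ad2 disc2 n A0 A1 A2 mA0 mA1 mA2.
pose J : finType := ('I_n.+1 * coord_index)%type.
pose E (lj : J) : set R := match lj.2 with
  | None => A0 lj.1 | Some (inl a) => A1 lj.1 a | Some (inr (a, b)) => A2 lj.1 a b end.
have mE lj : measurable (E lj).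
  by case: lj => l [[a|[a b]]|] /=; [exact: mA1|exact: mA2|exact: mA0].
have boxE T (Z : nat -> T -> noise R k) :
    [set w | forall l, (l <= n)%N -> noise_box (A0 l) (A1 l) (A2 l) (Z l w)] =
    [set w | forall lj : J, E lj (noise_coord (Z lj.1 w) lj.2)].
  apply/seteqP; split => w /= H.
    case=> l j; have [H0 H1 H2] := H l (leq_ord l).
    by case: j => [[a|[a b]]|] /=; [exact: H1|exact: H2|exact: H0].
  move=> l ln; have {}ln : (l < n.+1)%N by [].
  split; first exact: (H (Ordinal ln, None)).
    by move=> a; exact: (H (Ordinal ln, Some (inl a))).
  by move=> a b; exact: (H (Ordinal ln, Some (inr (a, b)))).
rewrite !boxE.
apply: (@eq_family_law_limit R J _ _ P1 _ _ P2 (fun lj w => noise_coord (Z1 lj.1 w) lj.2)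
  (fun lj w => noise_coord (Z2 lj.1 w) lj.2)) => //.
- by move=> lj; exact: (measurable_noise_coord fil1).
- by move=> lj; exact: (measurable_noise_coord fil2).
move=> e e0.
have [r1 r10 H1] := fine_mesh disc1 n e0.
have [r2 r20 H2] := fine_mesh disc2 n e0.
(* The smaller of the two thresholds yields one grid that is fine enough on both spaces. *)
have r0 : 0 < Num.min r1 r2 by rewrite lt_min r10.
have [q q0 Hq] := refined_grid_mesh tau0 tau_incr n r0.
have part (l : 'I_n.+1) r : Num.min r1 r2 <= r ->
    is_partition (tau l) r (l * q) (refined_grid tau q).
  move=> rr; apply: (@is_partition_refined_grid _ _ _ _ n) => //; first exact: leq_ord.
  by move=> i iq; apply: lt_le_trans (Hq i iq) rr.
exists (fun lj w => riemann_noise lj ((grid_increments W1 (n := n) (q := q))^~ w)).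
exists (fun lj w => riemann_noise lj ((grid_increments W2 (n := n) (q := q))^~ w)).
have mi1 ia := measurable_grid_increments fil1 br1 q0 (n := n) ia.
have mi2 ia := measurable_grid_increments fil2 br2 q0 (n := n) ia.
split; first by move=> lj; split; exact: measurable_riemann_noise.
split.
- apply: (eq_family_law_comp (Psi := fun lj => riemann_noise lj)) => //.
    move=> lj; apply: (measurable_riemann_noise _
      (x := fun ia (x : _.-tuple R) => tnth x (enum_rank ia))) => ia.
    exact: measurable_tnth.
  move=> E' mE'.
  (* Extends the sets to all natural indices; the default [setT] imposes nothing beyond the grid. *)
  pose E2 (i : nat) (a : 'I_k) : set R :=
    if insub i is Some i' then E' (i', a) else setT.
  have mE2 i a : measurable (E2 i a) by rewrite /E2; case: insubP.
  have sg0 : refined_grid tau q 0 = 0 by have := refined_gridM tau 0 q0; rewrite mul0n tau0.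
  have incE dT (T : measurableType dT) (W : R -> T -> 'cV[R]_k) :
      [set w | forall ia, E' ia (grid_increments W (n := n) (q := q) ia w)] =
      [set w | forall i, (i < n * q)%N -> forall a, E2 i a
        (W (refined_grid tau q i.+1) w a 0 - W (refined_grid tau q i) w a 0)].
    apply/seteqP; split => w /= H.
      move=> i iq a; rewrite /E2 insubT; exact: (H (Sub i iq, a)).
    by case=> i a; have := H i (ltn_ord i) a; rewrite /E2 valK.
  rewrite !incE.
  (* Both probabilities equal the same product of normal probabilities, whose variances depend on
     the grid alone. *)
  have incr i := refined_grid_incr tau_incr i q0.
  by rewrite (brownian_increments_law fil1 br1)// (brownian_increments_law fil2 br2).
- move=> [l j]; apply: (riemann_noise_near fil1 br1) => //= a b.
  by apply: H1; apply: part; rewrite ge_min lexx.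
- move=> [l j]; apply: (riemann_noise_near fil2 br2) => //= a b.
  by apply: H2; apply: part; rewrite ge_min lexx orbT.
Qed.

End driving_noise_law.

(** * The rotated noise *)

Section noise_group.
Context {R : realType} {k : nat}.
Implicit Types (z : noise R k) (B : 'M[R]_k).

Lemma nmulNV z : nmul (ninv z) z = nunit R k.
Proof.
rewrite /nmul /ninv /nunit /= !addNr linearN/= mulmxN.
by rewrite addrA addNr add0r addNr.
Qed.

Lemma nmulz1 z : nmul z (nunit R k) = z.
Proof. by case: z => [[t u] v]; rewrite /nmul /nunit/= !addr0 mul0mx add0r. Qed.

Lemma nmulKV z z' : nmul (nmul z z') (ninv z') = z.
Proof. by rewrite -nmulA nmulV nmulz1. Qed.

Lemma gauge_nmul B z z' : gauge B (nmul z z') = nmul (gauge B z) (gauge B z').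
Proof.
rewrite /gauge /nmul/=; congr (_, _, _); first exact: mulmxDr.
by rewrite !mulmxDr !mulmxDl trmx_mul !mulmxA.
Qed.

Lemma gauge_nunit B : gauge B (nunit R k) = nunit R k.
Proof. by rewrite /gauge /nunit/= !mulmx0 mul0mx. Qed.

End noise_group.

Section measurable_matrices.
Context {R : realType} d (Omega : measurableType d) (G : set (set Omega)).
Hypothesis sG : sigma_algebra setT G.

Lemma measurable_wrt_cst p q (A : 'M[R]_(p, q)) : measurable_wrt G (fun=> A).
Proof. by move=> i j; apply: measurable_for_cst. Qed.

Lemma measurable_wrtD p q (X Y : Omega -> 'M[R]_(p, q)) :
  measurable_wrt G X -> measurable_wrt G Y -> measurable_wrt G (fun w => X w + Y w).
Proof.
move=> mX mY i j E mE; rewrite (_ : [set w | _] = [set w | E (X w i j + Y w i j)]).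
  by apply: (measurable_forD sG (mX i j) (mY i j)).
by apply/seteqP; split => w /=; rewrite mxE.
Qed.

Lemma measurable_wrtN p q (X : Omega -> 'M[R]_(p, q)) :
  measurable_wrt G X -> measurable_wrt G (fun w => - X w).
Proof.
move=> mX i j E mE; rewrite (_ : [set w | _] = [set w | E (- X w i j)]).
  by apply: (measurable_forN sG (mX i j)).
by apply/seteqP; split => w /=; rewrite mxE.
Qed.

Lemma measurable_wrt_tr p q (X : Omega -> 'M[R]_(p, q)) :
  measurable_wrt G X -> measurable_wrt G (fun w => (X w)^T).
Proof.
move=> mX i j E mE; rewrite (_ : [set w | _] = [set w | E (X w j i)]); first exact: mX.
by apply/seteqP; split => w /=; rewrite mxE.
Qed.

Lemma measurable_wrt_mul p q r (X : Omega -> 'M[R]_(p, q)) (Y : Omega -> 'M[R]_(q, r)) :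
  measurable_wrt G X -> measurable_wrt G Y -> measurable_wrt G (fun w => X w *m Y w).
Proof.
move=> mX mY i j E mE; rewrite (_ : [set w | _] = [set w | E (\sum_l X w i l * Y w l j)]).
  apply: (measurable_for_sum sG (f := fun l w => X w i l * Y w l j)) => // l.
  exact: (measurable_forM sG (mX i l) (mY l j)).
by apply/seteqP; split => w /=; rewrite mxE.
Qed.

End measurable_matrices.

Lemma mulmx_continuous (R : realType) p q (B : 'M[R]_(p, q)) :
  continuous (mulmx B : 'cV[R]_q -> 'cV[R]_p).
Proof.
move=> x.
have E (y : 'cV[R]_q) : B *m y = \sum_j y j 0 *: col j B.
  apply/matrixP => i o; rewrite (ord1 o) mxE summxE; apply: eq_bigr => j _.
  by rewrite !mxE mulrC.
rewrite /continuous_at E (_ : mulmx B = fun y : 'cV[R]_q => \sum_j y j 0 *: col j B).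
  apply: (@cvg_sum _ _ _ (nbhs x) _ _ (fun j (y : 'cV[R]_q) => y j 0 *: col j B)) => j.
  by apply: cvgZr_tmp; exact: coord_continuous.
by apply/funext => y; rewrite E.
Qed.

Section gauge_transform.
Context {R : realType} {k : nat} (tau : nat -> R).
Hypotheses (tau0 : tau 0%N = 0) (tau_incr : forall l, tau l < tau l.+1).
Context d (Omega : measurableType d) (P : probability Omega R).
Variables (F : R -> set (set Omega)) (W : R -> Omega -> 'cV[R]_k)
  (Z : nat -> Omega -> noise R k).
Hypotheses (filF : is_filtration F) (brW : is_brownian P F W)
  (adZ : noise_adapted F tau Z) (discZ : is_discretization P tau W Z).
Variables (B : 'M[R]_k) (B_orth : B *m B^T = 1%:M).

Let tau_ge0 l : 0 <= tau l. Proof. exact: grid_ge0. Qed.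

Lemma is_brownian_rotate : is_brownian P F (fun t w => B *m W t w).
Proof.
have [adW [W0 [Wcont Wlaw]]] := brW; split.
  move=> t t0; apply: measurable_wrt_mul; first exact: (filtration_sigma filF).
    by apply: measurable_wrt_cst; exact: (filtration_sigma filF).
  exact: adW.
split; first by apply: filterS W0 => w ->; rewrite mulmx0.
split.
  apply: filterS Wcont => w cW x.
  exact: (cvg_comp _ _ (cW x) (@mulmx_continuous R k k B _)).
move=> s t s0 st A E FA mE.
have sd0 : Num.sqrt (t - s) != 0 by rewrite gt_eqF// sqrtr_gt0 subr_gt0.
have mA : measurable A by exact: (filtration_measurable filF s0).
have gV : gaussian_on P (Num.sqrt (t - s)) A (fun w => W t w - W s w).
  split=> [a|E' mE'].
    rewrite (_ : (fun w => _) = (fun w => W t w a 0 - W s w a 0)).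
      apply: measurable_funB; apply: (brownian_measurable filF brW) => //.
      exact: le_trans (ltW st).
    by apply/funext => w; rewrite !mxE.
  rewrite -Wlaw//; congr (P (_ `&` _)).
  by apply/seteqP; split => w /= H a; have := H a; rewrite !mxE.
have [_ /(_ E mE) <-] := gaussian_on_orthogonal sd0 mA (mulmx1C B_orth) gV.
have BE w a : (B *m (W t w - W s w)) a 0 = (B *m W t w) a 0 - (B *m W s w) a 0.
  by rewrite mulmxBr !mxE.
by congr (P (_ `&` _)); apply/seteqP; split => w /= H a; have := H a; rewrite BE.
Qed.

(** At time 0 the empty partition is admissible and its Riemann sum is 0, so [J] itself is small in
    probability at every scale, hence null. *)
Lemma ito_iterated_integral0 (J : Omega -> 'M[R]_k) :
  (forall a b, measurable_fun setT (fun w => J w a b)) ->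
  is_ito_iterated_integral P W 0 J -> {ae P, forall w, J w = 0}.
Proof.
move=> mJ itoJ.
have small a b (e : R) : 0 < e -> (P [set w | (e <= `|J w a b|)%R] <= e%:E)%E.
  move=> e0; have [delta d0 H] := itoJ a b e e0.
  have := H 0%N (fun=> 0); rewrite (_ : [set w | _] = [set w | (e <= `|J w a b|)%R]).
    by apply; split.
  by apply/seteqP; split => w /=; rewrite big_ord0 sub0r normrN.
have mset a b (e : R) : measurable [set w | (e <= `|J w a b|)%R].
  have := measurable_dist e (mJ a b) (measurable_cst (0 : R)).
  by congr measurable; apply/seteqP; split => w /=; rewrite subr0.
have null a b (e : R) : 0 < e -> P [set w | (e <= `|J w a b|)%R] = 0%E.
  move=> e0; apply/eqP; rewrite eq_le measure_ge0 andbT.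
  apply/lee_addgt0Pr => r r0; rewrite add0e.
  (* Lowering the threshold to [min e r] only enlarges the event, and bounds its probability by an
     arbitrary [r]. *)
  apply: (@le_trans _ _ (P [set w | (Num.min e r <= `|J w a b|)%R])).
    apply: le_measure; rewrite ?inE// => w /=; apply: le_trans.
    by rewrite ge_min lexx.
  apply: le_trans (small a b (Num.min e r) _) _; first by rewrite lt_min e0.
  by rewrite lee_fin ge_min lexx orbT.
have ae_ab (ab : 'I_k * 'I_k) : {ae P, forall w, J w ab.1 ab.2 = 0}.
  have H m : P.-negligible [set w | (m.+1%:R^-1 <= `|J w ab.1 ab.2|)%R].
    by apply/negligibleP => //; apply: null; rewrite invr_gt0.
  apply: negligibleS (negligible_bigcup H) => w /= Jw.
  have J0 : 0 < `|J w ab.1 ab.2| by rewrite normr_gt0; apply/eqP.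
  exists (Num.trunc (`|J w ab.1 ab.2|^-1)) => //=.
  by rewrite -[leRHS]invrK lef_pV2 ?posrE ?invr_gt0// ltW// truncnS_gt.
have ae_all : {ae P, forall w, forall ab : 'I_k * 'I_k, J w ab.1 ab.2 = 0}.
  exact: (@filter_forall _ _ (fun ab w => J w ab.1 ab.2 = 0) (almost_everywhere P) _ ae_ab).
apply: filterS ae_all => w Jw; apply/matrixP => a b; rewrite mxE.
exact: (Jw (a, b)).
Qed.

Lemma noise0_unit : {ae P, forall w, Z 0%N w = nunit R k}.
Proof.
have [Z0 [Z1 Z2]] := discZ 0%N; have [_ [W0 _]] := brW.
have mZ2 a b : measurable_fun setT (fun w => (Z 0%N w).2 a b).
  exact: (measurable_noise_coord tau0 tau_incr filF adZ 0 (Some (inr (a, b)))).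
rewrite tau0 in Z0 Z1 Z2; have Z2' := ito_iterated_integral0 mZ2 Z2.
move: Z2'; apply: filterS2 (filterI Z0 (filterI Z1 W0)) => w [/= Z0w [Z1w W0w]].
by move: Z0w Z1w; rewrite W0w; case: (Z 0%N w) => [[t u] v] /= -> -> ->.
Qed.

(** Closed form of [transform_Z] for a gauge that is constant along the solution. *)
Definition rotated_noise (l : nat) (w : Omega) : noise R k :=
  gauge B (nmul (Z l w) (ninv (Z 0%N w))).

Lemma rotated_noise_ae l : {ae P, forall w, rotated_noise l w = gauge B (Z l w)}.
Proof.
apply: filterS noise0_unit => w Z0; rewrite /rotated_noise Z0.
have -> : ninv (nunit R k) = nunit R k by rewrite -[LHS]nmulz1 nmulNV.
by rewrite nmulz1.
Qed.

Lemma rotated_noise_adapted : noise_adapted F tau rotated_noise.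
Proof.
move=> l; have sF := filtration_sigma filF (tau_ge0 l).
have [H0 H1 H2] := adZ l; have [K0 K1 K2] := adZ 0%N.
have F0l : F (tau 0%N) `<=` F (tau l).
  by apply: (filtration_mono filF) => //; exact: grid_mono.
have {}K0 : measurable_for (F (tau l)) (fun w => (Z 0%N w).1.1) by move=> E mE; apply/F0l/K0.
have {}K1 : measurable_wrt (F (tau l)) (fun w => (Z 0%N w).1.2) by move=> i j E mE; apply/F0l/K1.
have {}K2 : measurable_wrt (F (tau l)) (fun w => (Z 0%N w).2) by move=> i j E mE; apply/F0l/K2.
have mB p (A : 'M[R]_(k, p)) := measurable_wrt_cst sF A.
split.
- exact: (measurable_forD sF H0 (measurable_forN sF K0)).
- apply: (measurable_wrt_mul sF (mB _ B)); apply: (measurable_wrtD sF H1).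
  exact: measurable_wrtN.
- apply: (measurable_wrt_mul sF _ (mB _ B^T)); apply: (measurable_wrt_mul sF (mB _ B)).
  apply: (measurable_wrtD sF); first apply: (measurable_wrtD sF _ H2).
    apply: (measurable_wrt_mul sF); first exact: measurable_wrtN.
    exact: measurable_wrt_tr.
  apply: (measurable_wrtD sF); last exact: measurable_wrtN.
  apply: (measurable_wrt_mul sF) => //; exact: measurable_wrt_tr.
Qed.

(** Riemann sums are bilinear in the path, so the error for [B W] at [(a, b)] is the combination of
    the errors for [W] with coefficients [B a c * B b c']. *)
Lemma rotated_noise_discretization :
  is_discretization P tau (fun t w => B *m W t w) rotated_noise.
Proof.
move=> l; have [Z0 [Z1 Z2]] := discZ l; have Zae := rotated_noise_ae l.
split; first by move: Zae Z0; apply: filterS2 => w -> /=.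
split; first by move: Zae Z1; apply: filterS2 => w -> /= ->.
move=> a b e e0.
pose K := \sum_c \sum_d `|B a c * B b d|.
have K0 : 0 <= K by apply: sumr_ge0 => c _; apply: sumr_ge0.
pose N : R := (#|{: 'I_k * 'I_k}|%:R).
have N0 : 0 <= N by [].
have KN0 : 0 < 1 + K + N by rewrite -addrA ltr_pwDl// addr_ge0.
(* [K] absorbs the coefficients of the double sum, [N] the number of its terms. *)
pose e' := e / (1 + K + N).
have e'0 : 0 < e' by rewrite divr_gt0.
have [delta d0 H] := fine_mesh discZ l e'0.
exists delta => // n s part.
have s_ge0 i : (i <= n)%N -> 0 <= s i.
  have [s0 _ sr] := part; elim: i => [|i IH] ni; first by rewrite s0.
  by rewrite (le_trans (IH (ltnW ni)))// -subr_ge0; case/andP: (sr i ni).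
pose D (cd : 'I_k * 'I_k) := [set w | (e' <= `| \sum_(i < n) W (s i) w cd.1 0 *
    (W (s i.+1) w cd.2 0 - W (s i) w cd.2 0) - (Z l w).2 cd.1 cd.2|)%R].
have mriemann (V : R -> Omega -> 'cV[R]_k) c c' : is_brownian P F V -> measurable_fun setT (fun w =>
    \sum_(i < n) V (s i) w c 0 * (V (s i.+1) w c' 0 - V (s i) w c' 0)).
  move=> brV; apply: measurable_sum => i; apply: measurable_funM.
    by apply: (brownian_measurable filF brV); apply: s_ge0; exact: ltnW.
  by apply: measurable_funB; apply: (brownian_measurable filF brV); apply: s_ge0 => //; exact: ltnW.
have mD cd : measurable (D cd).
  apply: measurable_dist; first exact: mriemann.
  exact: (measurable_noise_coord tau0 tau_incr filF adZ l (Some (inr (cd.1, cd.2)))).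
have PD cd : (P (D cd) <= e'%:E)%E by exact: (H ord_max cd.1 cd.2).
have [mU PU] := probability_exists_le mD PD.
apply: (@le_trans _ _ (P [set w | exists cd, D cd w])); last first.
  apply: le_trans PU _; rewrite lee_fin /e' mulrCA ger_pMr// ler_pdivrMr// mul1r.
  by rewrite -/N lerDr addr_ge0.
apply: le_measure_ae => //.
  apply: measurable_dist; first exact: (mriemann _ a b is_brownian_rotate).
  exact: (measurable_noise_coord tau0 tau_incr filF rotated_noise_adapted l (Some (inr (a, b)))).
apply: filterS Zae => w Zw; rewrite /mkset; cbv beta; rewrite Zw => ew.
apply: contrapT => /forallNP nD.
have small c c' : `|\sum_(i < n) W (s i) w c 0 * (W (s i.+1) w c' 0 - W (s i) w c' 0)
    - (Z l w).2 c c'| <= e'.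
  by rewrite ltW// ltNge; apply/negP => h; exact: (nD (c, c') h).
move: ew; apply/negP; rewrite -ltNge.
have -> : \sum_(i < n) (B *m W (s i) w) a 0 * ((B *m W (s i.+1) w) b 0 - (B *m W (s i) w) b 0)
    - (B *m (Z l w).2 *m B^T) a b =
  \sum_c \sum_c' (B a c * B b c') * (\sum_(i < n) W (s i) w c 0 *
     (W (s i.+1) w c' 0 - W (s i) w c' 0) - (Z l w).2 c c').
  under [RHS]eq_bigr do under eq_bigr do rewrite mulrBr mulr_sumr.
  under [RHS]eq_bigr do rewrite sumrB exchange_big/=.
  rewrite sumrB exchange_big/=; congr (_ - _).
    apply: eq_bigr => i _; rewrite !mxE -sumrB mulr_suml; apply: eq_bigr => c _.
    rewrite mulr_sumr; apply: eq_bigr => c' _.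
    by rewrite -mulrBr mulrACA.
  rewrite mxE exchange_big/=; apply: eq_bigr => c' _.
  rewrite !mxE mulr_suml; apply: eq_bigr => c _; ring.
apply: le_lt_trans (ler_norm_sum _ _ _) _.
apply: (@le_lt_trans _ _ (K * e')).
  rewrite /K mulr_suml; apply: ler_sum => c _.
  rewrite (le_trans (ler_norm_sum _ _ _))// mulr_suml; apply: ler_sum => c' _.
  by rewrite normrM ler_wpM2l.
(* The summand 1 in the denominator makes the inequality [K e' < e] strict. *)
rewrite /e' mulrCA gtr_pMr// ltr_pdivrMr// mul1r.
by rewrite addrAC ltrDr ltr_pwDl.
Qed.

End gauge_transform.

Section rotated_jumps.
Context {R : realType} {m k : nat} (Omega : Type).
Variables (Phi : 'cV[R]_m -> 'cV[R]_m) (B : 'cV[R]_m -> 'M[R]_k) (X : nat -> Omega -> 'cV[R]_m)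
  (Z : nat -> Omega -> noise R k).

Lemma jump_transform_Z l w :
  jump (transform_Z B X Z) l w = gauge (B (X l w)) (jump Z l w).
Proof. by rewrite /jump/= nmulKV. Qed.

(** As the gauge is a morphism, the product of jumps telescopes: [Z_(l+1) Z_l^-1 Z_l Z_0^-1 =
    Z_(l+1) Z_0^-1]. *)
Lemma transform_Z_rotated B0 : (forall l w, B (X l w) = B0) ->
  transform_Z B X Z = fun l w => gauge B0 (nmul (Z l w) (ninv (Z 0%N w))).
Proof.
move=> BE; apply/funext => l; apply/funext => w; elim: l => [|l IH] /=.
  by rewrite nmulV gauge_nunit.
rewrite IH BE -gauge_nmul /jump; congr gauge.
by rewrite nmulA -[nmul (nmul _ (ninv _)) _]nmulA nmulNV nmulz1.
Qed.

End rotated_jumps.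

Theorem theorem7p5 (R : realType) (m k : nat)
  (M : set 'cV[R]_m) (M_open : open M)
  (mu : 'cV[R]_m -> 'cV[R]_m) (mu_smooth : smooth_on M mu)
  (sigma : 'cV[R]_m -> 'M[R]_(m, k)) (sigma_smooth : smooth_on M sigma)
  (tau : nat -> R) (tau0 : tau 0%N = 0)
  (tau_incr : forall l : nat, tau l < tau l.+1)
  (d0 : measure_display) (Omega0 : measurableType d0)
  (P0 : probability Omega0 R)
  (F0 : R -> set (set Omega0)) (F0_filtration : is_filtration F0)
  (W : R -> Omega0 -> 'cV[R]_k) (W_brownian : is_brownian P0 F0 W)
  (Z0 : nat -> Omega0 -> noise R k) (Z0_adapted : noise_adapted F0 tau Z0)
  (Z0_discretization : is_discretization P0 tau W Z0)
  (milstein_M : forall x z, M x -> M (milstein mu sigma x z))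
  (Y : 'cV[R]_m -> 'cV[R]_m) (C : 'cV[R]_m -> 'M[R]_k)
  (YC_symmetry : quasi_strong_symmetry M mu sigma Y C)
  (Y_linear : exists (A : 'M[R]_m) (b : 'cV[R]_m),
     forall x, M x -> Y x = A *m x + b)
  (C_constant : exists C0 : 'M[R]_k, forall x, M x -> C x = C0) :
  infinitesimal_weak_symmetry M (milstein mu sigma) tau P0 Z0 Y C.
Proof.
have [A [b YE]] := Y_linear; have [C0 CE] := C_constant.
have [_ [_ [C_skew [[Psi [Psi_flow _]] _]]]] := YC_symmetry.
split.
  exists Psi, (fun a _ => expm C0 a); split => // x Mx; split; first exact: expm0.
  move=> a; rewrite CE; first exact: is_derive_expml.
  exact: (flow_in Psi_flow).
move=> Phi B PhiB a; have flowPhi : is_flow M Y Phi by case: PhiB.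
have BE x : M x -> B a x = expm C0 a.
  by move=> Mx; exact: (generated_gauge CE PhiB).
have orth x : M x -> expm C0 a *m (expm C0 a)^T = 1%:M.
  by move=> Mx; apply: expm_orthogonal; rewrite -(CE x Mx) C_skew.
split; first exact: (flow_diffeomorphism M_open YE flowPhi).
split.
  apply: (affine_on_smooth M_open) => i j; exists (expm C0 a i j), 0 => x Mx.
  by rewrite /cpt BE// mul0mx [X in _ + X]mxE addr0.
split; first by move=> x Mx; rewrite BE// (orth x).
move=> d Omega P F X Z [filF [[adZ [W' [brW' discZ]]] [lawZ [XM [adX XG]]]]].
(* Orthogonality was derived over a point of [M]; the given solution supplies one at an arbitrary
   sample point. *)
have B_orth := orth _ (XM 0%N point).
have ZE := transform_Z_rotated Z (fun l w => BE _ (XM l w)).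
have ad_rot := rotated_noise_adapted tau0 tau_incr filF adZ (expm C0 a).
have br_rot := is_brownian_rotate filF brW' B_orth.
have disc_rot := rotated_noise_discretization tau0 tau_incr filF brW' adZ discZ B_orth.
split => //; split; first by rewrite ZE; split => //; exists (fun t w => expm C0 a *m W' t w).
split.
  rewrite ZE; exact: (driving_noise_law tau0 tau_incr filF br_rot ad_rot disc_rot
    F0_filtration W_brownian Z0_adapted Z0_discretization).
split; first by move=> l w; exact: (flow_in flowPhi).
split.
  move=> l; have sF : sigma_algebra setT (F (tau l)).
    by apply: (filtration_sigma filF); exact: (grid_ge0 tau0).
  (* [Phi a] is controlled on [M] only. Since [X] stays in [M], the affine formula about a fixed
     point of [M] reduces measurability to matrix operations. *)
  rewrite (_ : transform_X (Phi a) X l = fun w => Phi a (X 0%N point) +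
      expm A a *m (X l w + - X 0%N point)); last first.
    by apply/funext => w; rewrite -(flow_affine YE flowPhi).
  apply: measurable_wrtD => //; first exact: measurable_wrt_cst.
  apply: measurable_wrt_mul => //; first exact: measurable_wrt_cst.
  by apply: measurable_wrtD => //; exact: measurable_wrt_cst.
move=> l; apply: filterS (XG l) => w XGw.
rewrite jump_transform_Z /transform_X XGw BE//.
apply: (milstein_equivariant M_open mu_smooth sigma_smooth YC_symmetry YE CE PhiB) => //.
by rewrite -XGw.
Qed.
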